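(* Assume $\hat{\mathbf r}_\circ=\mathbf r$. Let $(\beta^{s'}_{s,k})$, $1\le s,s'\le\sigma$, $1\le k\le m$, be positive constants with $\beta_{s,k}=\prod_{s'=1}^\sigma\beta^{s'}_{s,k}$ and $\beta^{s'}_{s,k}\le1$ whenever $s\ne s'$. Set $\beta^s_k:=\sup_{1\le s'\le\sigma}\beta^s_{s',k}$, $\delta:=\inf_{1\le k\le m}\prod_{s=1}^\sigma(1\wedge\beta^s_k)$, $\gamma^\bullet_s:=\sup_k\beta^s_k\alpha^\bullet_{s,k}$, $\gamma^\circ_s:=\sup_k\alpha^\circ_{s,k}$, $C_\bullet:=B_\bullet\prod_{s=1}^\sigma\gamma^\bullet_s$, $C_\circ:=\delta^{-1}B_\circ\prod_{s=1}^\sigma\gamma^\circ_s$. Let $\hat p\in(0,1)$, assume $p_\circ:=1-(1-\hat p)^{-\sigma}C_\bullet>0$, and set $\varepsilon:=\hat p(1-\hat p)p_\circ C_\circ^{-1}$. Then $$1-\overline\rho(p)\le\frac{p}{\hat p(1-\hat p)}\qquad\text{for all }0\le p\le\varepsilon.$$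
   Context: Setting: $\Lambda$ a countable group with unit $0$, product $(i,j)\mapsto ij$; $h:\Lambda\to\mathbb Z$ a group homomorphism (height function). $\varphi_0\equiv0$ and $\varphi_1,\dots,\varphi_m$ are non-constant local monotone maps $\{0,1\}^\Lambda\to\{0,1\}$ depending only on coordinates in $\{i:h(i)=1\}$; $\mathbf r$ a probability distribution on $\{1,\dots,m\}$; $(\mu(i))$ i.i.d. with $\mathbb P[\mu(i)=0]=p$, $\mathbb P[\mu(i)=k]=(1-p)\mathbf r(k)$; $\Phi^p_i(x)=\varphi_{\mu(i)}((x(ij))_j)$; $\overline X^p$ is the maximal trajectory (pointwise maximal configuration $x$ with $x(i)=\Phi^p_i(x)$ for all $i$) and $\overline\rho(p):=\mathbb P[\overline X^p(i)=1]$. A minimal one-set of monotone local $\varphi$ is a finite $A\subset\Lambda$ with $\varphi(1_A)=1$ and minimal for inclusion with this property. For $1\le s\le\sigma$, $1\le k\le m$ fix a minimal one-set $A_{s,k}$ of $\varphi_k$; $\Delta_k:=\bigcup_sA_{s,k}$. A $\Lambda$-linear polar function of dimension $\sigma\ge2$ is a homomorphism $L:\Lambda\to(\mathbb R^\sigma,+)$ with $\sum_sL_s\equiv0$; fix one and $\lambda\in\mathbb R$. Fix subprobability distributions $\mathbf a^\bullet_{s,k}$ on $A_{s,k}$, $\mathbf a^\circ_{s,k}$ on $\Delta_k$, and probability distributions $\hat{\mathbf r}_t$ on $\{1,\dots,m\}$, $t\in\{\circ,1,\dots,\sigma\}$. Let $\alpha^\bullet_{s,k},\alpha^\circ_{s,k}\in[0,\infty]$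 be smallest with $e^{-\lambda L_s(i)}\le\alpha^\bullet_{s,k}\mathbf a^\bullet_{s,k}(i)$ ($i\in A_{s,k}$) and $e^{-\lambda L_s(i)}\le\alpha^\circ_{s,k}\mathbf a^\circ_{s,k}(i)$ ($i\in\Delta_k$); $\beta_{t,k}$ smallest with $\mathbf r(k)\le\beta_{t,k}\hat{\mathbf r}_t(k)$; $B_\star:=\sum_{j\in\Lambda}\sup_{1\le k\le m}\mathbf a^\star_{\sigma,k}(j)$ for $\star\in\{\bullet,\circ\}$. *)

(* Defs.v *)
From HB Require Import structures.
From mathcomp Require Import all_boot all_order all_algebra.
From mathcomp Require Import all_classical all_reals all_analysis.
Set Implicit Arguments.
Unset Strict Implicit.
Unset Printing Implicit Defensive.
Import Order.TTheory GRing.Theory Num.Theory.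
Local Open Scope classical_set_scope.
Local Open Scope ring_scope.

Record cgroup := CGroup {
  cg_car :> countType;
  cg_mul : cg_car -> cg_car -> cg_car;
  cg_one : cg_car;
  cg_inv : cg_car -> cg_car;
  cg_mulA : associative cg_mul;
  cg_mul1 : left_id cg_one cg_mul;
  cg_mulV : left_inverse cg_one cg_inv cg_mul }.

Definition height_fun (G : cgroup) (h : G -> int) :=
  forall i j : G, h (cg_mul i j) = h i + h j.

Definition conf (G : cgroup) := G -> bool.

Definition monotone_map (G : cgroup) (phi : conf G -> bool) :=
  forall x y : conf G, (forall j, x j ==> y j) -> phi x ==> phi y.

Definition nonconstant_map (G : cgroup) (phi : conf G -> bool) :=
  exists x y : conf G, phi x != phi y.

Definition depends_only_on (G : cgroup) (phi : conf G -> bool) (D : set G) :=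
  forall x y : conf G, (forall j, D j -> x j = y j) -> phi x = phi y.

Definition local_on_level_one (G : cgroup) (h : G -> int) (phi : conf G -> bool) :=
  exists D : set G, [/\ finite_set D, D `<=` [set i | h i = 1] &
                        depends_only_on phi D].

Definition indic (G : cgroup) (A : set G) : conf G := fun j => `[< A j >].

Definition minimal_one_set (G : cgroup) (phi : conf G -> bool) (A : set G) :=
  [/\ finite_set A, phi (indic A) = true &
      forall B : set G, B `<=` A -> phi (indic B) = true -> B = A].

(* the local maps at each site: mu i = None codes mu(i) = 0 (phi_0 = 0),
   mu i = Some k codes mu(i) = k+1 (phi_{k+1} = phi k) *)
Definition Phi (G : cgroup) (m : nat) (phi : 'I_m -> conf G -> bool)
  (mu : G -> option 'I_m) (x : conf G) (i : G) : bool :=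
  match mu i with
  | None => false
  | Some k => phi k (fun j => x (cg_mul i j))
  end.

Definition is_trajectory (G : cgroup) (m : nat) (phi : 'I_m -> conf G -> bool)
  (mu : G -> option 'I_m) (x : conf G) :=
  forall i, x i = Phi phi mu x i.

Definition is_maximal_trajectory (G : cgroup) (m : nat)
  (phi : 'I_m -> conf G -> bool) (mu : G -> option 'I_m) (x : conf G) :=
  is_trajectory phi mu x /\
  forall y, is_trajectory phi mu y -> forall i, y i ==> x i.

Definition prob_dist (R : realType) (m : nat) (r : 'I_m -> R) :=
  (forall k, 0 <= r k) /\ \sum_(k < m) r k = 1.

Definition subprob_on (R : realType) (G : cgroup) (A : set G) (a : G -> R) :=
  [/\ forall j, 0 <= a j, forall j, ~ A j -> a j = 0 &
      \sum_(j \in A) a j <= 1].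

Definition alpha_const (R : realType) (G : cgroup) (w : G -> R) (D : set G)
  (a : G -> R) : \bar R :=
  ereal_inf [set c : \bar R | (0 <= c)%E /\
                               forall i, D i -> ((w i)%:E <= c * (a i)%:E)%E].

Definition beta_const (R : realType) (rk rhk : R) : \bar R :=
  ereal_inf [set c : \bar R | (0 <= c)%E /\ (rk%:E <= c * rhk%:E)%E].

Definition polar_function (R : realType) (G : cgroup) (sigma : nat)
  (L : nat -> G -> R) :=
  (forall s (i j : G), (s < sigma)%N -> L s (cg_mul i j) = L s i + L s j) /\
  (forall i : G, \sum_(s < sigma) L s i = 0).

Definition site_law (R : realType) (d : measure_display) (Omega : measurableType d)
  (P : probability Omega R) (m : nat) (r : 'I_m -> R) (p : R)
  (X : Omega -> option 'I_m) :=
  (forall v, measurable [set w | X w = v]) /\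
  P [set w | X w = None] = p%:E /\
  (forall k, P [set w | X w = Some k] = ((1 - p) * r k)%:E).

Definition mutually_independent (R : realType) (d : measure_display)
  (Omega : measurableType d) (P : probability Omega R) (G : cgroup) (m : nat)
  (X : G -> Omega -> option 'I_m) :=
  forall (F : seq G) (v : G -> option 'I_m), uniq F ->
    P (\bigcap_(i in [set` F]) [set w | X i w = v i]) =
    (\prod_(i <- F) P [set w | X i w = v i])%E.

(* product of [0,oo]-valued quantities times a constant; +oo as soon as one
   factor is +oo (all the factors involved are > 0 in the paper's setting) *)
Definition prod_inf (R : realType) (c : \bar R) (sigma : nat) (g : nat -> \bar R)
  : \bar R :=
  if [forall s : 'I_sigma, g s != +oo%E] then (c * \prod_(s < sigma) g s)%E
  else +oo%E.

(* Main.v *)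
Require Import Defs.
From HB Require Import structures.
From mathcomp Require Import all_boot all_order all_algebra.
From mathcomp Require Import all_classical all_reals all_analysis.
From mathcomp Require Import ring zify.
Set Implicit Arguments.
Unset Strict Implicit.
Unset Printing Implicit Defensive.

(** A site [y] that is zero in the maximal trajectory and is not a defect (label
[None]) has, in each [A s (mu y)], a displacement to a zero of larger height.
Following one such displacement for the charge [s] leads to a defect.  Two
descents out of one zero whose defects are not yet connected are joined by a
fork; this yields a Toom contour at a zero [o]: finitely many sources
([o] and the forks) and, for every charge, disjoint paths that match the sources
with one common set of defects.

The contour is explored from [o], following all charges but the last forwards and
the last one backwards from each new defect.  Labels are revealed with the weights
[ph] and [(1 - ph) * rhat], steps are chosen with weights proportional to [abul]
and [acirc]; [p <= eps] says that the weights of the possible moves add up to at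
most 1.  Hence [P (o is a zero) <= c] for [c = p / (ph (1 - ph))], provided that
the labels revealed by a completed exploration have probability at most [c] times
the weight.  There the factors [expR (- lam * L s j)] multiply to 1, because
[L] is polar and all charges connect the same sources and defects; by heights all
charges make equally many steps, which bounds the powers of [1 - ph]; and the
constants [b] are shared out among the charges that pass a site. *)

(** * Trees of forks *)

(** Why suprema in [B_bul] and [B_circ]: a backward move picks its displacement before the label of
    the predecessor is known, so its weight has to dominate [abul] or [acirc] of the last charge for
    all [k] at once. Only one charge pays this price; the others follow forwards from the sources so
    found. Why [b] and [delta]: a label is revealed once, but several charges may pass its site. If
    charge [s0] reveals it, the ratio to [rhat s0] is at most the product over [s] of [b s s0 k].
    The factor of index [s] is charged to the step of charge [s] out of the site; if there is no
    such step, the factor is at most 1 by assumption. A site first met as a source is weighed with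
    [r] itself, but the steps out of it may bring factors below 1; [delta] bounds their product from
    below, hence one [delta^-1] per fork. Why these powers: a backward step stands for one step of
    each charge, each revealing at most one label, hence [(1 - ph) ^- sigma]; a fork brings one more
    label and one more defect, hence [p / (ph * (1 - ph))]. Defects outnumber forks by one. The
    exploration may miss part of the contour; a count shows that the part it covers is balanced as
    well. *)

Section Forks.
Variables (T : eqType) (sigma : nat) (nx : nat -> T -> T) (Z sink : pred T)
  (dp : T -> nat).
Hypothesis sigma0 : 0 < sigma.
Hypothesis nx_zero : forall s y, s < sigma -> Z y -> ~~ sink y ->
  Z (nx s y) /\ dp (nx s y) < dp y.
Hypothesis nx_sink : forall s y, sink y -> nx s y = y.

(** [dp] drops at every step out of a zero that is not a sink, so [dp y] steps reach a sink; surplus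
    steps rest there by [nx_sink]. *)
Definition endpoint s y := iter (dp y) (nx s) y.

Lemma iter_sink s y k : sink y -> iter k (nx s) y = y.
Proof. by move=> sy; elim: k => //= k ->; rewrite nx_sink. Qed.

Lemma iter_endpoint s y k : s < sigma -> Z y -> dp y <= k ->
  iter k (nx s) y = endpoint s y /\ sink (endpoint s y).
Proof.
move=> ss; rewrite /endpoint; move: {2}(dp y) (leqnn (dp y)) => n.
elim: n y k => [|n IH] y k le_n Zy le_k;
  case: (boolP (sink y)) => [sy|nsy]; try by rewrite !iter_sink.
  by have [_] := nx_zero ss Zy nsy; move: le_n; rewrite leqn0 => /eqP ->.
have [Znx dnx] := nx_zero ss Zy nsy.
case: (dp y) dnx le_n le_k => // d dnx le_d; case: k => // k le_k.
rewrite !iterSr.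
have le1 : dp (nx s y) <= n by exact: leq_trans dnx le_d.
have [-> sk] := IH (nx s y) k le1 Znx (leq_trans dnx le_k).
by have [-> _] := IH (nx s y) d le1 Znx dnx.
Qed.

Lemma endpoint_nx s y : s < sigma -> Z y -> endpoint s (nx s y) = endpoint s y.
Proof.
move=> ss Zy; case: (boolP (sink y)) => [sy|nsy]; first by rewrite nx_sink.
have [Znx dnx] := nx_zero ss Zy nsy.
have [<- _] := iter_endpoint ss Zy (leqnSn (dp y)).
by rewrite iterSr; have [-> _] := iter_endpoint ss Znx (ltnW dnx).
Qed.

Lemma endpoint_iter s y k : s < sigma -> Z y ->
  Z (iter k (nx s) y) /\ endpoint s (iter k (nx s) y) = endpoint s y.
Proof.
move=> ss Zy; elim: k => //= k [Zk ek]; rewrite endpoint_nx //; split=> //.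
case: (boolP (sink (iter k (nx s) y))) => [sy|nsy]; first by rewrite nx_sink.
by have [] := nx_zero ss Zk nsy.
Qed.

(** The first displacement of a path out of a fork may belong to any charge, whatever the charge of
    the path; this is why [acirc] lives on the union [Delta]. *)
Definition is_child u w := has (fun i => nx i u == w) (iota 0 sigma).

Definition source u := Z u && ~~ sink u.

(* C.1 are defects and C.2 forks: whichever defect f a further path of charge s
   occupies, the paths of charge s from the forks can end in all the others. *)
Definition fork_tree (C : seq T * seq T) :=
  uniq C.1 /\ all source C.2 /\
  forall s f, s < sigma -> f \in C.1 ->
    exists2 ch, all2 is_child C.2 ch & perm_eq (f :: map (endpoint s) ch) C.1.

(* A forest assigns to each defect the tree that contains it. *)
Definition forest (F : T -> seq T * seq T) :=
  forall f, [/\ f \in (F f).1, fork_tree (F f) &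
                forall g, g \in (F f).1 -> F g = F f].

Definition coarser (F' F : T -> seq T * seq T) :=
  forall f g, g \in (F f).1 -> g \in (F' f).1.

Definition together (F : T -> seq T * seq T) (us : seq T) :=
  forall s u s' u', s < sigma -> s' < sigma -> u \in us -> u' \in us ->
    endpoint s' u' \in (F (endpoint s u)).1.

Lemma all2_catl (A B : Type) (r : A -> B -> bool) (s1 s2 : seq A) (t1 t2 : seq B) :
  all2 r s1 t1 -> all2 r s2 t2 -> all2 r (s1 ++ s2) (t1 ++ t2).
Proof. by elim: s1 t1 => [|x s1 IH] [|y t1] //= /andP[-> /IH]; apply. Qed.

(** The new fork passes the free place on. If [f] lies in the first tree, the path out of [u] goes
    through [w'], and its endpoint is the occupied defect of the second tree; if [f] lies in the
    second tree, the path goes through [w]. *)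
Lemma fork_tree_merge C C' u w w' : fork_tree C -> fork_tree C' ->
  source u -> is_child u w -> is_child u w' -> ~~ has (mem C.1) C'.1 ->
  (forall s, s < sigma -> endpoint s w \in C.1) ->
  (forall s, s < sigma -> endpoint s w' \in C'.1) ->
  fork_tree (C.1 ++ C'.1, u :: C.2 ++ C'.2).
Proof.
move=> [uC [sC tC]] [uC' [sC' tC']] su cw cw' dis eC eC'; split.
  by rewrite cat_uniq uC uC' dis.
split; first by rewrite /= su all_cat sC sC'.
move=> s f ss; rewrite mem_cat => /orP[fC|fC'] /=.
  have [ch c1 p1] := tC s f ss fC.
  have [ch' c2 p2] := tC' s _ ss (eC' s ss).
  exists (w' :: ch ++ ch'); first by rewrite /= cw' all2_catl.
  rewrite /= map_cat; apply/permP => a; move/permP: p1 => /(_ a) /=.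
  move/permP: p2 => /(_ a) /=; rewrite !count_cat /= => <- <-.
  by rewrite !addnA; congr addn; rewrite -!addnA; congr addn; rewrite addnC.
have [ch c1 p1] := tC s _ ss (eC s ss).
have [ch' c2 p2] := tC' s f ss fC'.
exists (w :: ch ++ ch'); first by rewrite /= cw all2_catl.
rewrite /= map_cat; apply/permP => a; move/permP: p1 => /(_ a) /=.
move/permP: p2 => /(_ a) /=; rewrite !count_cat /= => <- <-.
by rewrite addnCA -!addnA; congr addn; rewrite addnCA.
Qed.

(** Trees that share a defect coincide. So [w'] either leads into the tree of [w] already, or the
    two trees are disjoint and [u] becomes a fork between them. *)
Lemma forest_merge F u w w' us : forest F -> source u -> is_child u w ->
  is_child u w' -> together F (w :: us) -> together F [:: w'] ->
  exists F', [/\ forest F', coarser F' F & together F' (w' :: w :: us)].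
Proof.
move=> fF su cw cw' tw tw'.
pose f := endpoint 0 w; pose f' := endpoint 0 w'.
have [ff Tf Ef] := fF f; have [ff' Tf' Ef'] := fF f'.
have ew s : s < sigma -> endpoint s w \in (F f).1.
  by move=> ss; apply: tw; rewrite ?mem_head.
have ew' s : s < sigma -> endpoint s w' \in (F f').1.
  by move=> ss; apply: tw'; rewrite ?mem_head.
have eus s x : s < sigma -> x \in w :: us -> endpoint s x \in (F f).1.
  by move=> ss xw; apply: tw; rewrite ?mem_head.
case: (boolP (f' \in (F f).1)) => [/Ef e|nf].
  exists F; split=> //; have all_f s x : s < sigma -> x \in w' :: w :: us ->
      endpoint s x \in (F f).1.
    move=> ss; rewrite inE => /predU1P[->|]; last exact: eus.
    by rewrite -e; apply: ew'.
  by move=> s x s' x' ss ss' xx xx'; rewrite (Ef _ (all_f s x ss xx)); apply: all_f.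
have dis : ~~ has (mem (F f).1) (F f').1.
  apply/hasPn => g gf' /=; apply: contra nf => gf.
  by rewrite -(Ef _ gf) (Ef' _ gf').
pose C := ((F f).1 ++ (F f').1, u :: (F f).2 ++ (F f').2).
have TC : fork_tree C by apply: (fork_tree_merge Tf Tf' su cw cw').
pose F' x := if x \in C.1 then C else F x.
have F'C x : x \in C.1 -> F' x = C by rewrite /F' => ->.
exists F'; split.
- move=> x; rewrite /F'; case: ifPn => [xC|nxC].
    by split=> // g gC; rewrite gC.
  have [xx Tx Ex] := fF x; split=> // g gx; case: ifPn => [|_]; last exact: Ex.
  rewrite mem_cat => /orP[gf|gf]; case/negP: nxC; rewrite mem_cat.
    by rewrite -(Ef _ gf) (Ex _ gx) xx.
  by rewrite -(Ef' _ gf) (Ex _ gx) xx orbT.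
- move=> x g gx; rewrite /F'; case: ifPn => // xC; rewrite mem_cat.
  move: xC; rewrite mem_cat => /orP[xf|xf].
    by rewrite -(Ef _ xf) gx.
  by rewrite -(Ef' _ xf) gx orbT.
- have all_C s x : s < sigma -> x \in w' :: w :: us -> endpoint s x \in C.1.
    move=> ss; rewrite inE mem_cat => /predU1P[->|xw]; first by rewrite ew' ?orbT.
    by rewrite eus.
  by move=> s x s' x' ss ss' xx xx'; rewrite F'C all_C.
Qed.

Lemma coarser_together F F' us : coarser F' F -> together F us -> together F' us.
Proof. by move=> c t s u s' u' *; apply: c; apply: t. Qed.

(** Induction on the depth. The children of [u] are settled one charge at a time, and each is joined
    to the previous ones, where necessary, by a fork at [u]. Thus [u] may be listed several times,
    and [fork_tree] asks no uniqueness of its forks. *)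
Lemma forest_together u F : Z u -> forest F ->
  exists F', [/\ forest F', coarser F' F & together F' [:: u]].
Proof.
move: {2}(dp u) (leqnn (dp u)) => n; elim: n u F => [|n IH] u F le_n Zu fF;
  have sinkcase : sink u ->
     exists F', [/\ forest F', coarser F' F & together F' [:: u]].
- move=> sk; exists F; split=> // s x s' x' _ _ /[!inE] /eqP -> /eqP ->.
  by rewrite /endpoint !iter_sink //; have [] := fF u.
- case: (boolP (sink u)) => // nsu; have [_] := nx_zero sigma0 Zu nsu.
  by move: le_n; rewrite leqn0 => /eqP ->.
- move=> sk; exists F; split=> // s x s' x' _ _ /[!inE] /eqP -> /eqP ->.
  by rewrite /endpoint !iter_sink //; have [] := fF u.
case: (boolP (sink u)) => // nsu {sinkcase}.
have ch s : s < sigma -> is_child u (nx s u).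
  by move=> ss; apply/hasP; exists s => //; rewrite mem_iota.
have step t : 0 < t <= sigma -> exists F' us, [/\ forest F', coarser F' F,
    together F' (nx t.-1 u :: us) & forall s, s < t -> nx s u \in nx t.-1 u :: us].
  elim: t => // -[|t] IHt /andP[_ lt].
    have [Z1 d1] := nx_zero lt Zu nsu.
    have [F' [fF' cF' tF']] := IH _ F (leq_trans d1 le_n) Z1 fF.
    by exists F', [::]; split=> // -[|s] //; rewrite mem_head.
  have [F1 [us [fF1 cF1 tF1 m1]]] := IHt (ltnW lt).
  have [Z1 d1] := nx_zero lt Zu nsu.
  have [F2 [fF2 cF2 tF2]] := IH _ F1 (leq_trans d1 le_n) Z1 fF1.
  have [|||||F3 [fF3 cF3 tF3]] := @forest_merge F2 u (nx t u) (nx t.+1 u) us fF2.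
  - by rewrite /source Zu.
  - exact: ch (ltnW lt).
  - exact: ch.
  - exact: coarser_together tF1.
  - exact: tF2.
  exists F3, (nx t u :: us); split=> //; first by move=> f g /cF1/cF2/cF3.
  move=> s; rewrite ltnS leq_eqVlt => /predU1P[->|/m1]; first exact: mem_head.
  by move=> ms; rewrite inE ms orbT.
have /step[F' [us [fF' cF' tF' mF']]] : 0 < sigma <= sigma by rewrite sigma0 leqnn.
exists F'; split=> // s x s' x' ss ss' /[!inE] /eqP -> /eqP ->.
by rewrite -(endpoint_nx ss Zu) -(endpoint_nx ss' Zu); apply: tF'; rewrite // mF'.
Qed.

Lemma exists_fork_tree u : Z u -> exists K E,
  fork_tree (K, E) /\ forall s, s < sigma -> endpoint s u \in K.
Proof.
move=> Zu.
have f0 : forest (fun f => ([:: f], [::])).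
  move=> f; split=> /=; first exact: mem_head.
  - by split=> //; split=> // s g ss /[!inE] /eqP ->; exists [::].
  - by move=> g /[!inE] /eqP ->.
have [F [fF _ tF]] := forest_together Zu f0.
have [_ TF _] := fF (endpoint 0 u).
exists (F (endpoint 0 u)).1, (F (endpoint 0 u)).2; split; first by case: (F _) TF.
by move=> s ss; apply: tF; rewrite ?mem_head.
Qed.

End Forks.

Import Order.TTheory GRing.Theory Num.Theory.
Local Open Scope classical_set_scope.
Local Open Scope ring_scope.

(** * Exploration of the labels *)

(** [Fwd s x] continues the path of charge [s] at [x], [Src s x] takes the first step of charge [s]
    out of the fork [x], and [Back x] looks for what precedes [x] on a path of the last charge. *)
Inductive task (G : Type) := Fwd of nat & G | Src of nat & G | Back of G.
Arguments Fwd {G}.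
Arguments Src {G}.
Arguments Back {G}.

Definition task_site (G : Type) (t : task G) : G :=
  match t with Fwd _ x => x | Src _ x => x | Back x => x end.

Definition task_charge (sig : nat) (G : Type) (t : task G) : nat :=
  match t with Fwd s _ => s | Src s _ => s | Back _ => sig end.

(** The index of the distribution used if the task reveals a label; [None] stands for the
    distribution of sources. *)
Definition task_type (sig : nat) (G : Type) (t : task G) : option nat :=
  match t with Fwd s _ => Some s | Src _ _ => None | Back _ => Some sig end.

Definition lookup (T : eqType) (U : Type) (lab : seq (T * U)) (x : T) : option U :=
  ohead [seq q.2 | q <- lab & q.1 == x].

Lemma lookup_mem (T : eqType) (U : eqType) (lab : seq (T * U)) (q : T * U) :
  uniq (unzip1 lab) -> q \in lab -> lookup lab q.1 = Some q.2.
Proof.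
elim: lab => //= a lab IH /andP[na un]; rewrite inE /lookup /= => /predU1P[->|qlab].
  by rewrite eqxx.
case: eqP => [e|_]; last exact: IH.
by case/negP: na; rewrite e; apply: map_f.
Qed.

(** * Countable unions *)

Lemma bigcup_pickle (I : countType) (T : Type) (F : I -> set T) :
  \bigcup_(i in [set: I]) F i =
  \bigcup_n (if pickle_inv n is Some i then F i else set0).
Proof.
apply/seteqP; split => w [].
  by move=> i _ Fi; exists (pickle i) => //; rewrite pickleK_inv.
by move=> n _; case: pickle_inv => // i Fi; exists i.
Qed.

Section CountableUnion.
Context (R : realType) (d : measure_display) (T : measurableType d)
  (P : probability T R).

Lemma measurable_bigcup_countType (I : countType) (F : I -> set T) :
  (forall i, measurable (F i)) -> measurable (\bigcup_(i in [set: I]) F i).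
Proof.
move=> mF; rewrite bigcup_pickle; apply: bigcupT_measurable => n.
by case: pickle_inv.
Qed.

Lemma prob_nondecreasing_le (F : (set T)^nat) (M : R) :
  (forall n, measurable (F n)) -> (forall n, F n `<=` F n.+1) ->
  (forall n, (P (F n) <= M%:E)%E) -> (P (\bigcup_n F n) <= M%:E)%E.
Proof.
move=> mF ndF le_M.
have cF : P \o F @ \oo --> P (\bigcup_n F n).
  apply: nondecreasing_cvg_mu => //; first exact: bigcupT_measurable.
  apply/nondecreasing_seqP => n; apply/subsetPset; exact: ndF.
rewrite -(cvg_lim _ cF) //; apply: lime_le; first by apply/cvg_ex; eexists; exact: cF.
by near=> n; apply: le_M.
Unshelve. all: by end_near.
Qed.

(** Bounds on all finite subsums replace an infinite sum, since the union is an increasing limit of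
    finite unions. *)
Lemma prob_bigcup_countType_le (I : countType) (F : I -> set T) (a : I -> R) (M : R) :
  (forall i, measurable (F i)) -> (forall i, (P (F i) <= (a i)%:E)%E) ->
  (forall s : seq I, uniq s -> \sum_(i <- s) a i <= M) ->
  (P (\bigcup_(i in [set: I]) F i) <= M%:E)%E.
Proof.
move=> mF Fa aM; rewrite bigcup_pickle.
set F' := fun n => _; have mF' n : measurable (F' n).
  by rewrite /F'; case: pickle_inv.
have -> : \bigcup_n F' n = \bigcup_n \big[setU/set0]_(k < n) F' k.
  apply/seteqP; split => w [n _].
    by move=> F'n; exists n.+1 => //; rewrite big_ord_recr; right.
  by rewrite -bigcup_mkord => -[k /= _ Fk]; exists k.
have mU n : measurable (\big[setU/set0]_(k < n) F' k) by apply: bigsetU_measurable.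
apply: prob_nondecreasing_le => // n; first by rewrite big_ord_recr; left.
have un : uniq (pmap (@pickle_inv I) (iota 0 n)).
  by apply: pmap_uniq (iota_uniq _ _) => k; apply: pickle_invK.
apply: (@le_trans _ _ (\sum_(i <- pmap (@pickle_inv I) (iota 0 n)) a i)%:E); last first.
  by rewrite lee_fin aM.
elim: n {un} => [|n IH]; first by rewrite big_ord0 measure0 big_nil.
rewrite big_ord_recr -[X in iota 0 X]addn1 iotaD pmap_cat big_cat EFinD /=.
apply: le_trans (measureU2 _ _ _) _; [exact: mU|exact: mF'|].
apply: leeD => //; rewrite /F' add0n; case: pickle_inv => [i|] /=.
  by rewrite big_seq1.
by rewrite measure0 big_nil.
Qed.

End CountableUnion.

(** * The exploration and its union bound *)

Section Exploration.
Context (R : realType) (G : cgroup) (m : nat) (d : measure_display)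
  (Omega : measurableType d) (P : probability Omega R)
  (mu : G -> Omega -> option 'I_m) (r : 'I_m -> R) (p : R).
Hypothesis mu_law : forall i, site_law P r p (mu i).
Hypothesis mu_indep : mutually_independent P mu.

Definition label_prob (l : option 'I_m) : R :=
  if l is Some k then (1 - p) * r k else p.

Definition cylinder (lab : seq (G * option 'I_m)) : set Omega :=
  [set w | all (fun q => mu q.1 w == q.2) lab].

Lemma measurable_cylinder lab : measurable (cylinder lab).
Proof.
elim: lab => [|q lab IH].
  by rewrite (_ : cylinder _ = setT) //; apply/seteqP.
have -> : cylinder (q :: lab) = [set w | mu q.1 w = q.2] `&` cylinder lab.
  apply/seteqP; split => w /=; first by case/andP=> /eqP.
  by case=> e al; apply/andP; split; first exact/eqP.
by apply: measurableI => //; have [] := mu_law q.1.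
Qed.

Lemma prob_cylinder lab : uniq (unzip1 lab) ->
  P (cylinder lab) = (\prod_(q <- lab) label_prob q.2)%:E.
Proof.
move=> un; pose v i := odflt None (lookup lab i).
have vE q : q \in lab -> v q.1 = q.2 by move=> ql; rewrite /v lookup_mem.
have -> : cylinder lab =
    \bigcap_(i in [set` unzip1 lab]) [set w | mu i w = v i].
  apply/seteqP; split => w /=.
    move=> /allP al i /= /mapP[q ql ->]; rewrite vE //; exact/eqP/al.
  by move=> al; apply/allP => q ql; rewrite -(vE q ql); apply/eqP/al/map_f.
rewrite mu_indep // big_map -prodEFin [LHS]big_seq [RHS]big_seq.
apply: eq_bigr => q ql; rewrite vE //.
have [_ [pN pS]] := mu_law q.1.
by case: q.2 => [k|] /=; rewrite ?pS ?pN.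
Qed.

Variables (sig : nat) (o : G) (ph : R) (rh : option nat -> 'I_m -> R)
  (abul acirc : nat -> 'I_m -> G -> R) (gb gc : R) (sb sc : G -> R) (c0 : R).

Definition label_weight t (l : option 'I_m) : R :=
  if l is Some k then (1 - ph) * rh t k else ph.

(** The weight is compared with the law of the labels only at leaves. A leaf that fails the test
    contributes [set0], so the union bound holds for all explorations, and the test has to be
    verified only along contours. *)
Definition good_leaf (lab : seq (G * option 'I_m)) (acc : R) :=
  uniq (unzip1 lab) && (\prod_(q <- lab) label_prob q.2 <= c0 * acc).

(* The labellings compatible with some run of at most N moves of the
   exploration that starts from the revealed labels lab, the pending tasks todo
   and the accumulated weight acc, and that ends in a good leaf. *)
Fixpoint explored (N : nat) (lab : seq (G * option 'I_m)) (todo : seq (task G))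
    (acc : R) : set Omega :=
  if N isn't N'.+1 then set0 else
  if todo isn't t :: td then (if good_leaf lab acc then cylinder lab else set0)
  else if (sig < task_charge sig t)%N then set0 else
  match lookup lab (task_site t) with
  | None =>
      \bigcup_(l in [set: option 'I_m])
        explored N' ((task_site t, l) :: lab)
          (if l is None then t :: Back (task_site t) :: td else t :: td)
          (acc * label_weight (task_type sig t) l)
  | Some l =>
    match t, l with
    | Fwd s x, Some k =>
        \bigcup_(j in [set: G])
          explored N' lab (Fwd s (cg_mul x j) :: td) (acc * abul s k j)
    | Fwd _ _, None => explored N' lab td acc
    | Src s x, Some k =>
        \bigcup_(j in [set: G])
          explored N' lab (Fwd s (cg_mul x j) :: td) (acc * acirc s k j)
    | Src _ _, None => set0
    | Back x, _ =>
        if x == o then explored N' lab td acc else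
        (\bigcup_(j in [set: G])
          explored N' lab (Back (cg_mul x (cg_inv j)) :: td) (acc * (gb * sb j)))
        `|` (\bigcup_(j in [set: G])
          explored N' lab
            ([seq Src s (cg_mul x (cg_inv j)) | s <- iota 0 sig] ++ td)
            (acc * (gc * sc j)))
    end
  end.

Lemma exploredS N lab todo acc :
  explored N lab todo acc `<=` explored N.+1 lab todo acc.
Proof.
elim: N lab todo acc => [//|N IH] lab [|t td] acc; try by move=> ?.
rewrite [explored N.+1 _ _ _]/= [explored N.+2 _ _ _]/= -!/(explored N.+1).
case: ifP => _; first by move=> ?.
case: (lookup lab (task_site t)) => [l|]; last first.
  by apply: subset_bigcup => l _; apply: IH.
case: t => [s x|s x|x].
- by case: l => [k|]; [apply: subset_bigcup => j _; apply: IH | apply: IH].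
- case: l => [k|]; last by move=> ?.
  by apply: subset_bigcup => j _; apply: IH.
- case: ifP => _; first exact: IH.
  by apply: setUSS; apply: subset_bigcup => j _; apply: IH.
Qed.

Lemma measurable_explored N lab todo acc : measurable (explored N lab todo acc).
Proof.
elim: N lab todo acc => [|N IH] lab [|t td] acc //=.
  by case: ifP => _ //; apply: measurable_cylinder.
case: ifP => // _; case: (lookup lab (task_site t)) => [l|]; last by apply: measurable_bigcup_countType => l; apply: IH.
case: t => [s x|s x|x].
- by case: l => [k|]; [apply: measurable_bigcup_countType => j; apply: IH | apply: IH].
- by case: l => [k|] //; apply: measurable_bigcup_countType => j; apply: IH.
- case: ifP => _; first exact: IH.
  by apply: measurableU; apply: measurable_bigcup_countType => j; apply: IH.
Qed.

Hypothesis c0_ge0 : 0 <= c0.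
Hypothesis ph01 : 0 <= ph <= 1.
Hypothesis rh_prob : forall t, (odflt 0%N t <= sig)%N ->
  (forall k, 0 <= rh t k) /\ \sum_(k < m) rh t k = 1.
Hypothesis abul_sub : forall s k, (s <= sig)%N -> (forall j, 0 <= abul s k j) /\
  forall J, uniq J -> \sum_(j <- J) abul s k j <= 1.
Hypothesis acirc_sub : forall s k, (s <= sig)%N -> (forall j, 0 <= acirc s k j) /\
  forall J, uniq J -> \sum_(j <- J) acirc s k j <= 1.
Hypothesis gb_ge0 : forall j, 0 <= gb * sb j.
Hypothesis gc_ge0 : forall j, 0 <= gc * sc j.
Variables (Bb Bc : R).
Hypothesis back_bul : forall J, uniq J -> \sum_(j <- J) gb * sb j <= Bb.
Hypothesis back_circ : forall J, uniq J -> \sum_(j <- J) gc * sc j <= Bc.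
Hypothesis BbBc : Bb + Bc <= 1.

Lemma label_weight_ge0 t l : (odflt 0%N t <= sig)%N ->
  0 <= label_weight t l.
Proof.
move=> /rh_prob[rh0 _]; case/andP: ph01 => ph0 ph1.
by case: l => [k|] //=; rewrite mulr_ge0 ?subr_ge0.
Qed.

Lemma label_weight_sum t (s : seq (option 'I_m)) :
  (odflt 0%N t <= sig)%N -> uniq s ->
  \sum_(l <- s) label_weight t l <= 1.
Proof.
move=> ht us; apply: (@le_trans _ _ (\sum_(l : option 'I_m) label_weight t l)).
  rewrite big_uniq //= [leRHS](bigID (mem s)) /= lerDl sumr_ge0 // => l _.
  exact: label_weight_ge0.
rewrite (bigD1 None) //= (reindex_omap Some id) /=; last by case.
rewrite (eq_bigl xpredT); last by move=> k; rewrite eqxx.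
have [_ rh1] := rh_prob ht.
by rewrite -mulr_sumr rh1 mulr1 addrC subrK.
Qed.

(** A union bound without disjointness: the weights of the moves open at any moment add up to at
    most 1, so the bound [c0 * acc] is inherited from the successors; at a leaf it is
    [good_leaf]. *)
Lemma prob_explored N lab todo acc : 0 <= acc ->
  (P (explored N lab todo acc) <= (c0 * acc)%:E)%E.
Proof.
have step (I : countType) (F : I -> set Omega) (a : I -> R) ac M :
    0 <= ac -> (forall i, measurable (F i)) ->
    (forall i, (P (F i) <= (c0 * (ac * a i))%:E)%E) ->
    (forall s : seq I, uniq s -> \sum_(i <- s) a i <= M) ->
    (P (\bigcup_(i in [set: I]) F i) <= (c0 * (ac * M))%:E)%E.
  move=> ac0 mF Fa aM; apply: prob_bigcup_countType_le mF Fa _ => s us.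
  by rewrite -!mulr_sumr !ler_wpM2l // aM.
have P0 ac : 0 <= ac -> (P set0 <= (c0 * ac)%:E)%E.
  by move=> ac0; rewrite measure0 lee_fin mulr_ge0.
elim: N lab todo acc => [|N IH] lab [|t td] acc acc0 /=; try exact: P0.
  case: ifP => [/andP[un le_W]|_]; last exact: P0.
  by rewrite prob_cylinder // lee_fin.
(* The assumptions on the distributions stop at charge [sig]; beyond it [explored] is empty. *)
case: ltnP => [_|le_s]; first exact: P0.
case: (lookup lab (task_site t)) => [l|]; last first.
  have ht : (odflt 0%N (task_type sig t) <= sig)%N by case: t le_s.
  rewrite -[acc in leRHS]mulr1; apply: step => // [l|l|s].
  - exact: measurable_explored.
  - by apply: IH; apply: mulr_ge0 => //; apply: label_weight_ge0.
  - exact: label_weight_sum.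
case: t le_s => [s x|s x|x] /= le_s.
- case: l => [k|]; last exact: IH.
  have [a0 a1] := abul_sub k le_s.
  rewrite -[acc in leRHS]mulr1; apply: step a1 => // j.
    exact: measurable_explored.
  by apply: IH; rewrite mulr_ge0.
- case: l => [k|]; last exact: P0.
  have [a0 a1] := acirc_sub k le_s.
  rewrite -[acc in leRHS]mulr1; apply: step a1 => // j.
    exact: measurable_explored.
  by apply: IH; rewrite mulr_ge0.
case: ifP => _; first exact: IH.
apply: le_trans (measureU2 _ _ _) _;
  try by apply: measurable_bigcup_countType => j; apply: measurable_explored.
(* A backward task splits its unit mass between a step of the last charge, [Bb], and the entry into
   a source, [Bc]. *)
apply: (@le_trans _ _ ((c0 * (acc * Bb))%:E + (c0 * (acc * Bc))%:E)%E).
  apply: leeD; [apply: (step G _ (fun j => gb * sb j))|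
                apply: (step G _ (fun j => gc * sc j))] => // j;
    by first [exact: measurable_explored | apply: IH; rewrite mulr_ge0].
by rewrite -EFinD lee_fin -!mulrDr ler_wpM2l // ler_piMr.
Qed.

End Exploration.

(** * Contours *)

Section Contour.
Context (G : cgroup) (m : nat) (v : G -> option 'I_m) (sig : nat) (o : G)
  (h : G -> int) (nx : nat -> G -> G) (n Q : nat) (src : nat -> G)
  (st : nat -> nat -> G).

Local Open Scope nat_scope.

Definition path_sites s : seq G :=
  [seq iter q (nx s) (st s e) | e <- iota 0 n, q <- iota 0 Q.+1].

(** Source 0 is the root, whose paths start at [o] itself; for [e > 0] the path of charge [s] starts
    at [st s e], one displacement away from the fork [src e]. [Q] is a common number of steps after
    which every path rests in its defect. *)
Record is_contour : Prop := IsContour {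
  contour_charges : 0 < sig;
  contour_sources : 0 < n;
  contour_root : forall s, st s 0 = o;
  contour_nx_sink : forall s y, s <= sig -> ~~ v y -> nx s y = y;
  contour_end : forall s e, s <= sig -> e < n ->
    ~~ v (iter Q (nx s) (st s e));
  contour_inj : forall s e e', s <= sig -> e < n -> e' < n ->
    iter Q (nx s) (st s e) = iter Q (nx s) (st s e') -> e = e';
  contour_surj : forall s e, s <= sig -> e < n ->
    exists2 e', e' < n & iter Q (nx sig) (st sig e') = iter Q (nx s) (st s e);
  contour_height : forall s y, s <= sig -> y \in path_sites s -> v y ->
    h (nx s y) = (h y + 1)%R;
  contour_src_height : forall s e, s <= sig -> 0 < e < n ->
    h (st s e) = (h (src e) + 1)%R;
  contour_src : forall e, 0 < e < n -> v (src e)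
}.

Hypothesis C : is_contour.

Let sig0 := contour_charges C.
Let nx_sinkE := contour_nx_sink C.

Lemma iter_nx_sink s y k : s <= sig -> ~~ v y -> iter k (nx s) y = y.
Proof. by move=> ss nv; elim: k => //= k ->; apply: nx_sinkE. Qed.

Lemma iter_pathP s x : s <= sig -> reflect (exists e q, e < n /\ x = iter q (nx s) (st s e))
  (x \in path_sites s).
Proof.
move=> ss; apply: (iffP allpairsP) => [[[e q]] /=|[e [q [en ->]]]].
  by rewrite !mem_iota => -[en _ ->]; exists e, q; rewrite add0n in en; split.
have [qQ|Qq] := leqP q Q; first by exists (e, q); rewrite !mem_iota ltnS qQ en.
exists (e, Q); rewrite !mem_iota ltnSn en; split=> //=.
by rewrite -(subnK (ltnW Qq)) iterD iter_nx_sink // contour_end.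
Qed.

Lemma path_st s e : s <= sig -> e < n -> st s e \in path_sites s.
Proof. by move=> ss en; apply/iter_pathP => //; exists e, 0. Qed.

Lemma path_nx s x : s <= sig -> x \in path_sites s -> nx s x \in path_sites s.
Proof.
move=> ss /(iter_pathP _ ss)[e [q [en ->]]]; apply/iter_pathP => //.
by exists e, q.+1.
Qed.

Lemma path_root s : s <= sig -> o \in path_sites s.
Proof. by move=> ss; rewrite -(contour_root C s) path_st // (contour_sources C). Qed.

Lemma path_pred s x : s <= sig -> x \in path_sites s ->
  (exists2 e, e < n & x = st s e) \/
  (exists y, [/\ y \in path_sites s, v y & x = nx s y]).
Proof.
move=> ss /(iter_pathP _ ss)[e [q [en ->]]]; elim: q => [|q IH].
  by left; exists e.
case: (boolP (isSome (v (iter q (nx s) (st s e))))) => [vy|nv].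
  by right; exists (iter q (nx s) (st s e)); split=> //; apply/iter_pathP => //; exists e, q.
by rewrite iterS nx_sinkE.
Qed.

Lemma height_iter s e q : s <= sig -> e < n -> v (iter q (nx s) (st s e)) ->
  h (iter q (nx s) (st s e)) = (h (st s e) + q%:Z)%R.
Proof.
move=> ss en; elim: q => [|q IH]; first by rewrite addr0.
rewrite iterS; case: (boolP (isSome (v (iter q (nx s) (st s e))))) => [vy _|nv]; last first.
  by rewrite nx_sinkE // (negbTE nv).
rewrite contour_height // ?IH // -?addrA ?intS ?[(1 + _)%R]addrC //.
by apply/iter_pathP => //; exists e, q.
Qed.

Lemma iter_path_end s x : s <= sig -> x \in path_sites s ->
  exists e q, [/\ e < n, x = iter q (nx s) (st s e) &
    iter Q (nx s) x = iter Q (nx s) (st s e)].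
Proof.
move=> ss /(iter_pathP _ ss)[e [q [en ->]]]; exists e, q; split=> //.
by rewrite -iterD addnC iterD iter_nx_sink // contour_end.
Qed.

Lemma iter_nx_end s x : s <= sig -> x \in path_sites s ->
  iter Q (nx s) (nx s x) = iter Q (nx s) x.
Proof.
move=> ss xp; have [e [q [en _ xe]]] := iter_path_end ss xp.
by rewrite -iterSr iterS nx_sinkE // xe contour_end.
Qed.

(** Equal successors have equal path ends, so by [contour_inj] both sites lie on one path; equal
    heights then give equal positions on it. *)
Lemma nx_inj s y y' : s <= sig -> y \in path_sites s -> y' \in path_sites s ->
  v y -> v y' -> nx s y = nx s y' -> y = y'.
Proof.
move=> ss py py' vy vy' E.
have [e [q [en yE ye]]] := iter_path_end ss py.
have [e' [q' [en' yE' ye']]] := iter_path_end ss py'.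
have ee : e = e'.
  by apply: (contour_inj C ss) => //; rewrite -ye -ye' -iter_nx_end // E iter_nx_end.
have : h y = h y'.
  by apply: (addIr 1%R); rewrite -(contour_height C ss py vy) E contour_height.
rewrite -ee in en' yE'; rewrite [in h y]yE [in h y']yE' !height_iter -?yE -?yE' //.
by move=> /addrI [qq]; rewrite yE yE' qq.
Qed.

Lemma st_inj s e e' : s <= sig -> e < n -> e' < n -> st s e = st s e' -> e = e'.
Proof. by move=> ss en en' E; apply: (contour_inj C ss) => //; rewrite E. Qed.

(** Otherwise [y] would lie on the path that starts at [st s e], yet one level below its start. *)
Lemma nx_st s y e : s <= sig -> y \in path_sites s -> v y -> e < n ->
  nx s y <> st s e.
Proof.
move=> ss py vy en E.
have [e' [q [en' yE ye]]] := iter_path_end ss py.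
have ee : e' = e.
  by apply: (contour_inj C ss) => //; rewrite -ye -E iter_nx_end.
have := contour_height C ss py vy.
rewrite E [in h y]yE ee height_iter -?ee -?yE // -addrA => /eqP.
by rewrite -subr_eq0 opprD addrA subrr add0r oppr_eq0 -PoszD addn1.
Qed.

Lemma path_sink s x : s <= sig -> x \in path_sites s -> ~~ v x ->
  x \in path_sites sig.
Proof.
move=> ss px nvx; have [e [q [en _ xe]]] := iter_path_end ss px.
move: xe; rewrite iter_nx_sink // => ->.
have [e' en' <-] := contour_surj C ss en.
by apply/iter_pathP => //; exists e', Q.
Qed.

(* (s, inl x) is the path of charge s at x, (s, inr e) the start of charge s at
   the source e. *)
Definition token := (nat * (G + nat))%type.

(** Tokens [(s, inr e)] stop short of charge [sig]: its first step out of a fork is taken backwards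
    and discovers the fork. *)
Definition valid (t : token) : bool :=
  match t with
  | (s, inl x) => (s <= sig) && (x \in path_sites s)
  | (s, inr e) => (s < sig) && (0 < e < n)
  end.

(* Charges below sig are followed forwards, charge sig backwards: the children
   of a token are the tokens that processing it adds to the agenda. *)
Definition children (t : token) : seq token :=
  match t with
  | (s, inl x) =>
    if s == sig then
      [seq (s', inr e) | e <- [seq e <- iota 1 n.-1 | st sig e == x], s' <- iota 0 sig] ++
      [seq (sig, inl y) | y <- [seq y <- undup (path_sites sig) | v y && (nx sig y == x)]]
    else if v x then [:: (s, inl (nx s x))] else [::]
  | (s, inr e) => [:: (s, inl (st s e))]
  end.

Lemma filter_uniq1 (T : eqType) (l : seq T) (a : pred T) x :
  uniq l -> x \in l -> (forall y, y \in l -> a y = (y == x)) -> [seq y <- l | a y] = [:: x].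
Proof.
move=> ul xl ax; rewrite (eq_in_filter ax).
by apply: perm_small_eq => //; rewrite uniq_perm ?filter_uniq // => y;
   rewrite mem_filter !inE; case: eqP => // ->.
Qed.

(** Walking backwards along a contour is deterministic: fork starts, proper steps and the root
    exclude one another by [nx_st] and [st_inj]. *)
Lemma children_back_st e : 0 < e < n ->
  children (sig, inl (st sig e)) = [seq (s, inr e) | s <- iota 0 sig].
Proof.
case/andP=> e0 en; rewrite /= eqxx (@filter_uniq1 _ _ _ e) ?iota_uniq //.
- rewrite (@eq_in_filter _ _ pred0) ?filter_pred0 /= ?cats0 // => y.
  rewrite mem_undup => py; case vy: (v y) => //=; apply/eqP.
  by apply: nx_st; rewrite ?vy.
- by rewrite mem_iota e0 add1n prednK // (contour_sources C).
- move=> e'; rewrite mem_iota add1n prednK ?(contour_sources C) // => /andP[_ e'n].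
  by apply/eqP/eqP => [|->] //; apply: st_inj.
Qed.

Lemma children_back_nx y : y \in path_sites sig -> v y ->
  children (sig, inl (nx sig y)) = [:: (sig, inl y)].
Proof.
move=> py vy; rewrite /= eqxx (@eq_in_filter _ _ pred0) ?filter_pred0 /=; last first.
  move=> e; rewrite mem_iota add1n prednK ?(contour_sources C) // => /andP[_ en].
  by rewrite eq_sym; apply/eqP/nx_st.
rewrite (@filter_uniq1 _ _ _ y) ?undup_uniq ?mem_undup // => y'.
rewrite mem_undup => py'; apply/andP/eqP => [[vy' /eqP E]|->]; last by rewrite vy.
exact: nx_inj E.
Qed.

Lemma children_back_root : children (sig, inl o) = [::].
Proof.
rewrite /= eqxx (@eq_in_filter _ _ pred0) ?filter_pred0 /=; last first.
  move=> e; rewrite mem_iota add1n prednK ?(contour_sources C) // => /andP[e0 en].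
  rewrite -(contour_root C sig); apply/eqP => /st_inj e00.
  by move: e0; rewrite e00 // (contour_sources C).
rewrite (@eq_in_filter _ _ pred0) ?filter_pred0 // => y.
rewrite mem_undup => py; case vy: (v y) => //=; apply/eqP.
by rewrite -(contour_root C sig); apply: nx_st; rewrite ?vy ?(contour_sources C).
Qed.

Variant child_spec : token -> token -> Prop :=
  | ChildBackSt e s of 0 < e < n & s < sig :
      child_spec (sig, inl (st sig e)) (s, inr e)
  | ChildBackNx y of y \in path_sites sig & v y :
      child_spec (sig, inl (nx sig y)) (sig, inl y)
  | ChildNx s y of s < sig & y \in path_sites s & v y :
      child_spec (s, inl y) (s, inl (nx s y))
  | ChildSt s e of s < sig & 0 < e < n :
      child_spec (s, inr e) (s, inl (st s e)).

Lemma childrenP t t' : valid t -> t' \in children t -> child_spec t t'.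
Proof.
case: t => s [x|e] /= /andP[ss px]; last by rewrite !inE => /eqP ->; constructor.
case: (eqVneq s sig) => [es|ns]; last first.
  have {}ss : s < sig by rewrite ltn_neqAle ns ss.
  by case: ifP => // vx; rewrite inE => /eqP ->; constructor.
rewrite {}es {ss} mem_cat => /orP[/allpairsP[[e s']]|/mapP[y]].
  rewrite /= mem_filter !mem_iota /= add1n prednK ?(contour_sources C) //.
  by move=> [/andP[/eqP <- e0n] s's ->]; constructor.
by rewrite mem_filter mem_undup => /andP[/andP[vy /eqP <-] py] ->; constructor.
Qed.

Lemma children_valid t t' : valid t -> t' \in children t -> valid t'.
Proof.
move=> vt /(childrenP vt)[e s e0 ss|y py _|s y ss py _|s e ss /andP[_ en]] /=.
- by rewrite ss.
- by rewrite leqnn.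
- by rewrite ltnW //= path_nx // ltnW.
- by rewrite ltnW //= path_st // ltnW.
Qed.

Lemma children_fwdP t s z : s < sig -> valid t -> (s, inl z) \in children t ->
  (exists y, [/\ t = (s, inl y), y \in path_sites s, v y & z = nx s y]) \/
  (exists e, [/\ t = (s, inr e), 0 < e < n & z = st s e]).
Proof.
move=> ss vt; move E: (s, inl z) => t' /(childrenP vt) c.
case: c E => [//|y _ _ [es _]|s' y ss' py vy [-> ->]|s' e ss' e0n [-> ->]].
- by move: ss; rewrite es ltnn.
- by left; exists y.
- by right; exists e.
Qed.

Lemma children_backP t y : valid t -> (sig, inl y) \in children t ->
  [/\ t = (sig, inl (nx sig y)), y \in path_sites sig & v y].
Proof.
move=> vt; move E: (sig, inl y) => t' /(childrenP vt) c.
by case: c E => [//|y' py vy [->]|s' y' ss' py vy [es _]|s' e ss' e0n [es _]] //;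
  move: ss'; rewrite -es ltnn.
Qed.

Lemma children_srcP t s e : valid t -> (s, inr e) \in children t ->
  [/\ t = (sig, inl (st sig e)), 0 < e < n & s < sig].
Proof.
move=> vt; move E: (s, inr e) => t' /(childrenP vt) c.
by case: c E => // e' s' e0n ss' [-> ->].
Qed.

(** Forward tokens have one parent because paths of one charge are disjoint, backward and fork
    tokens because they determine the site they were found from. Hence no token is pushed twice. *)
Lemma children_inj t1 t2 t : valid t1 -> valid t2 ->
  t \in children t1 -> t \in children t2 -> t1 = t2.
Proof.
move=> v1 v2 c1 c2; have := children_valid v1 c1.
case: t c1 c2 => s [z|e] c1 c2 /=; last first.
  by have [-> _ _] := children_srcP v1 c1; have [-> _ _] := children_srcP v2 c2.
case/andP; rewrite leq_eqVlt => /predU1P[es|ss] _.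
  move: c1 c2; rewrite es => c1 c2.
  by have [-> _ _] := children_backP v1 c1; have [-> _ _] := children_backP v2 c2.
have [[y1 [-> p1 vy1 z1]]|[e1 [-> /andP[_ e1n] z1]]] := children_fwdP ss v1 c1;
  have [[y2 [-> p2 vy2 z2]]|[e2 [-> /andP[_ e2n] z2]]] := children_fwdP ss v2 c2.
- by congr (_, inl _); apply: (nx_inj (ltnW ss)); rewrite -?z1 -?z2.
- by case: (nx_st (ltnW ss) p1 vy1 e2n); rewrite -z1 -z2.
- by case: (nx_st (ltnW ss) p2 vy2 e1n); rewrite -z1 -z2.
- by congr (_, inr _); apply: (st_inj (ltnW ss)); rewrite -?z1 -?z2.
Qed.

Lemma children_uniq t : valid t -> uniq (children t).
Proof.
case: t => s [x|e] //= _; case: ifP => _; last by case: ifP.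
rewrite cat_uniq; apply/and3P; split.
- by apply: allpairs_uniq => [||[e1 s1] [e2 s2] _ _ [-> ->]] //;
    rewrite ?filter_uniq ?iota_uniq.
- by apply/hasPn => t /mapP[y _ ->]; apply/negP => /allpairsP[[e s'] /= [_ _]].
- by rewrite map_inj_uniq => [|y y' [->]] //; rewrite filter_uniq ?undup_uniq.
Qed.

End Contour.

(** * Exploration along a contour *)

Section GhostRun.
Context (G : cgroup) (m : nat) (v : G -> option 'I_m) (sig : nat) (o : G)
  (h : G -> int) (nx : nat -> G -> G) (n Q : nat) (src : nat -> G)
  (st : nat -> nat -> G).
Hypothesis C : is_contour v sig o h nx n Q src st.

Notation token := (token G).
Notation valid := (valid sig nx n Q st).
Notation children := (children v sig nx n Q st).
Notation path_sites := (path_sites nx n Q st).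

Definition token_site (t : token) : G :=
  match t.2 with inl x => x | inr e => src e end.

Definition token_type (t : token) : option nat :=
  match t.2 with inl _ => Some t.1 | inr _ => None end.

(** The tokens without a parent: the initial agenda, and the backward task added by each newly
    revealed defect. *)
Definition root_tokens (lab : seq (G * option nat)) : seq token :=
  [seq (s, inl o) | s <- iota 0 sig] ++ [seq (sig, inl q.1) | q <- lab & ~~ v q.1].

(* In lab, a revealed site carries the charge along which it was first reached,
   or None if it was first visited as a source. *)
Record run_inv (lab : seq (G * option nat)) (V todo : seq token) : Prop := RunInv {
  run_uniq : uniq (V ++ todo);
  run_valid : forall t, t \in V ++ todo -> valid t;
  run_perm : perm_eq (V ++ todo) (root_tokens lab ++ flatten (map children V));
  run_lab : uniq (unzip1 lab);
  run_type : forall q, q \in lab ->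
    exists2 t, t \in V ++ todo & q = (token_site t, token_type t);
  run_seen : forall t, t \in V -> token_site t \in unzip1 lab
}.

Lemma run_inv0 : run_inv [::] [::] [seq (s, inl o) | s <- iota 0 sig].
Proof.
split=> //=.
- by rewrite map_inj_uniq ?iota_uniq // => s s' [].
- move=> t /mapP[s]; rewrite mem_iota add0n => ss -> /=.
  by rewrite ltnW //= (path_root C) // ltnW.
- by rewrite /root_tokens /= !cats0.
Qed.

Lemma run_inv_reveal lab V t td : run_inv lab V (t :: td) ->
  v (token_site t) -> token_site t \notin unzip1 lab ->
  run_inv ((token_site t, token_type t) :: lab) V (t :: td).
Proof.
case=> u va pe ul ty se vt tl; split=> //=.
- by move: pe; rewrite /root_tokens /= vt.
- by rewrite tl.
- move=> q; rewrite inE => /predU1P[->|/ty //]; exists t => //.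
  by rewrite mem_cat mem_head orbT.
- by move=> t' /se; rewrite inE => ->; rewrite orbT.
Qed.

Lemma valid_sink t : valid t -> ~~ v (token_site t) ->
  token_site t \in path_sites sig.
Proof.
case: t => s [x|e] /= /andP[ss px]; first exact: (path_sink C ss px).
by rewrite (contour_src C).
Qed.

Lemma run_inv_sink lab V t td : run_inv lab V (t :: td) ->
  ~~ v (token_site t) -> token_site t \notin unzip1 lab ->
  run_inv ((token_site t, token_type t) :: lab) V
    (t :: (sig, inl (token_site t)) :: td).
Proof.
case=> u va pe ul ty se vt tl; set x := token_site t in vt tl *.
have perm_new : perm_eq (V ++ t :: (sig, inl x) :: td) ((sig, inl x) :: V ++ t :: td).
  by apply/permP => a; rewrite /= !count_cat /= !(addnCA _ (a (sig, inl x))).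
split.
(* The backward token of [x] is new: it is no root because [x] was not revealed before, and no child
   because children of charge [sig] sit at sites that are not defects. *)
- rewrite (perm_uniq perm_new) /= u andbT (perm_mem pe) mem_cat negb_or.
  apply/andP; split.
    rewrite mem_cat negb_or; apply/andP; split; apply/mapP => -[].
      by move=> s; rewrite mem_iota add0n => ss [e _]; move: ss; rewrite -e ltnn.
    move=> q; rewrite mem_filter => /andP[_ ql] [xq].
    by case/negP: tl; rewrite xq; apply: map_f.
  apply/flatten_mapP => -[t' t'V] /(children_backP C) [|_ _ vx].
    by apply: va; rewrite mem_cat t'V.
  by rewrite vx in vt.
- move=> t'; rewrite (perm_mem perm_new) inE => /predU1P[->|/va //] /=.
  have /va : t \in V ++ t :: td by rewrite mem_cat mem_head orbT.
  by rewrite leqnn => /valid_sink; apply.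
- rewrite (perm_trans perm_new) // /root_tokens /= vt /=.
  apply: (@perm_trans _ ((sig, inl x) :: root_tokens lab ++ flatten (map children V))).
    by rewrite perm_cons.
  by apply/permP => a; rewrite /= /root_tokens !count_cat /= -!addnA [RHS]addnCA.
- by rewrite /= tl.
- move=> q; rewrite inE => /predU1P[->|/ty[t' t'M ->]].
    by exists t => //; rewrite mem_cat mem_head orbT.
  by exists t' => //; rewrite (perm_mem perm_new) inE t'M orbT.
- by move=> t' /se /=; rewrite inE => ->; rewrite orbT.
Qed.

Lemma run_inv_move lab V t td : run_inv lab V (t :: td) ->
  token_site t \in unzip1 lab -> run_inv lab (t :: V) (children t ++ td).
Proof.
case=> u va pe ul ty se tl.
have tM : t \in V ++ t :: td by rewrite mem_cat mem_head orbT.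
have perm_new : perm_eq ((t :: V) ++ children t ++ td) (children t ++ V ++ t :: td).
  apply/permP => a; rewrite /= !count_cat /=.
  by rewrite !(addnCA _ (a t)) (addnCA (count a V)).
have vt : valid t by apply: va.
split=> //.
(* The children are new: no step and no fork start leads to [o], backward children are not defects,
   and another parent in [V] would have to be [t] itself. *)
- rewrite (perm_uniq perm_new) cat_uniq u (children_uniq v vt) andbT /=.
  apply/hasPn => t' t'M; apply/negP => /= t'c.
  move: t'M; rewrite (perm_mem pe) mem_cat => /orP[|/flatten_mapP[t2 t2V t'2]].
    rewrite mem_cat => /orP[/mapP[s]|/mapP[q]].
      rewrite mem_iota add0n => /= ss t'E; rewrite t'E in t'c.
      have [[y [_ py vy]]|[e [_ /andP[e0 en]]]] := children_fwdP C ss vt t'c.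
        rewrite -(contour_root C s) => /esym; apply: (nx_st C (ltnW ss) py vy).
        exact: (contour_sources C).
      rewrite -(contour_root C s) => /(st_inj C (ltnW ss) (contour_sources C) en) e0'.
      by move: e0; rewrite -e0'.
    rewrite mem_filter => /andP[nv _] t'E; rewrite t'E in t'c.
    by have [_ _ vq] := children_backP C vt t'c; rewrite vq in nv.
  have v2 : valid t2 by apply: va; rewrite mem_cat t2V.
  have t2E := children_inj C v2 vt t'2 t'c.
  by move: u; rewrite cat_uniq => /and3P[_ /hasPn /(_ t)]; rewrite mem_head -t2E /= t2V => /(_ isT).
- move=> t'; rewrite (perm_mem perm_new) mem_cat => /orP[t'c|/va //].
  exact: (children_valid C vt t'c).
- rewrite (perm_trans perm_new) //= .
  apply: (@perm_trans _ (children t ++ (root_tokens lab ++ flatten (map children V)))).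
    by rewrite perm_cat2l.
  by apply/permP => a; rewrite /= !count_cat addnCA.
- move=> q /ty[t' t'M ->]; exists t' => //.
  by rewrite (perm_mem perm_new) mem_cat t'M orbT.
- by move=> t'; rewrite inE => /predU1P[->|/se].
Qed.

Definition token_universe : seq token :=
  [seq (s, inl x) | s <- iota 0 sig.+1, x <- path_sites s] ++
  [seq (s, inr e) | s <- iota 0 sig, e <- iota 0 n].

Lemma valid_universe t : valid t -> t \in token_universe.
Proof.
case: t => s [x|e] /= /andP[ss px]; rewrite mem_cat; apply/orP.
  by left; apply/allpairsPdep; exists s, x; split; rewrite // mem_iota.
right; apply/allpairsP; exists (s, e); split; rewrite // mem_iota //.
by case/andP: px.
Qed.

(** Every move processes a token or reveals a label. Both lists are bounded by the finite universe,
    so this number drops and the exploration of a contour terminates. *)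
Definition run_measure (lab : seq (G * option nat)) (V : seq token) :=
  ((size token_universe - size V) + (size token_universe - size lab))%N.

Lemma run_size lab V todo : run_inv lab V todo ->
  (size V <= size token_universe)%N /\ (size lab <= size token_universe)%N.
Proof.
case=> u va pe ul ty se; split.
  apply: uniq_leq_size; first by move: u; rewrite cat_uniq => /andP[].
  by move=> t tV; apply/valid_universe/va; rewrite mem_cat tV.
rewrite -(size_map token_site) -(size_map fst); apply: uniq_leq_size => // x.
case/mapP => q /ty[t tM ->] ->; apply/map_f/valid_universe; exact: va.
Qed.

End GhostRun.

(** * Weights of explorations along a contour *)

Section GhostWeight.
Context (R : realType) (G : cgroup) (m : nat) (sig : nat) (o : G)
  (h : G -> int) (nx : nat -> G -> G) (n Q : nat) (src : nat -> G)
  (st : nat -> nat -> G) (d : measure_display)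
  (Omega : measurableType d) (mu : G -> Omega -> option 'I_m)
  (w : Omega).
Local Notation v := (fun i => mu i w).
Hypothesis C : is_contour v sig o h nx n Q src st.

Notation token := (token G).
Notation valid := (valid sig nx n Q st).
Notation children := (children v sig nx n Q st).
Notation path_sites := (path_sites nx n Q st).
Notation run_inv := (run_inv v sig o nx n Q src st).
Notation token_site := (token_site src).

Variables (r : 'I_m -> R) (p ph : R) (rh : option nat -> 'I_m -> R)
  (abul acirc : nat -> 'I_m -> G -> R) (gb gc : R) (sb sc : G -> R) (c0 : R).

Definition task_of (t : token) : task G :=
  match t with
  | (s, inl x) => if s == sig then Back x else Fwd s x
  | (s, inr e) => Src s (src e)
  end.

Definition jump (x y : G) : G := cg_mul (cg_inv x) y.

Lemma cg_mulrV x : cg_mul x (cg_inv x) = cg_one G.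
Proof.
rewrite -[LHS]cg_mul1 -{1}(cg_mulV (cg_inv x)) -cg_mulA.
by rewrite [cg_mul (cg_inv x) _]cg_mulA cg_mulV cg_mul1 cg_mulV.
Qed.

Lemma cg_mulr1 (x : G) : cg_mul x (cg_one G) = x.
Proof. by rewrite -(cg_mulV x) cg_mulA cg_mulrV cg_mul1. Qed.

Lemma mul_jump x y : cg_mul x (jump x y) = y.
Proof. by rewrite /jump cg_mulA cg_mulrV cg_mul1. Qed.

Lemma mul_inv_jump x y : cg_mul y (cg_inv (jump x y)) = x.
Proof. by rewrite -[X in cg_mul X _](mul_jump x) -cg_mulA cg_mulrV cg_mulr1. Qed.

Definition label_of (lab : seq (G * option nat)) : seq (G * option 'I_m) :=
  [seq (q.1, v q.1) | q <- lab].

Definition move_weight (t : token) : R :=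
  match t with
  | (s, inl x) =>
    if s == sig then 1 else
    if v x is Some k then abul s k (jump x (nx s x)) else 1
  | (s, inr e) =>
    if v (src e) is Some k then acirc s k (jump (src e) (st s e)) else 1
  end.

(* A backward step is weighed with the token it pushes; the step into a source e
   pushes sig tokens, of which (0, inr e) carries the weight. *)
Definition push_weight (t : token) : R :=
  match t with
  | (s, inl y) => if (s == sig) && v y then gb * sb (jump y (nx sig y)) else 1
  | (s, inr e) => if s == 0%N then gc * sc (jump (src e) (st sig e)) else 1
  end.

Definition run_weight (lab : seq (G * option nat)) (V todo : seq token) : R :=
  (\prod_(q <- lab) label_weight ph rh q.2 (v q.1)) *
  (\prod_(t <- V) move_weight t) * \prod_(t <- V ++ todo) push_weight t.

Lemma run_weight_move lab V t td :
  run_weight lab (t :: V) (children t ++ td) =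
  run_weight lab V (t :: td) * (move_weight t * \prod_(t' <- children t) push_weight t').
Proof.
rewrite /run_weight !big_cat !big_cons /=.
set a := \prod_(q <- lab) _; set b := \prod_(j <- V) move_weight j.
set c := \prod_(j <- V) push_weight j; set e := \prod_(j <- children t) _.
ring.
Qed.

Lemma task_of_site t : task_site (task_of t) = token_site t.
Proof. by case: t => s [x|e] //=; case: ifP. Qed.

Lemma task_of_type t : task_type sig (task_of t) = token_type t.
Proof. by case: t => s [x|e] //=; case: eqP => //= ->. Qed.

Lemma task_of_charge t : valid t -> (task_charge sig (task_of t) <= sig)%N.
Proof. by case: t => s [x|e] /= /andP[ss _]; [case: ifP | apply: ltnW]. Qed.

Lemma lookup_label_of lab x : lookup (label_of lab) x =
  if x \in unzip1 lab then Some (v x) else None.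
Proof.
elim: lab => //= a lab; rewrite /lookup /= inE [x == _]eq_sym.
by case: eqP => [->|_].
Qed.

Notation explored_run lab V todo N := (explored mu r p sig o ph rh abul acirc gb gc sb sc
  c0 N (label_of lab) (map task_of todo) (run_weight lab V todo) w).

(** In each union over displacements the witness is the one the contour makes, recovered by [jump],
    also for steps taken backwards. *)
Lemma explored_move lab V t td N : run_inv lab V (t :: td) ->
  token_site t \in unzip1 lab ->
  explored_run lab (t :: V) (children t ++ td) N ->
  explored_run lab V (t :: td) N.+1.
Proof.
move=> inv tl; rewrite run_weight_move map_cat.
have vt : valid t by apply: (run_valid inv); rewrite mem_cat mem_head orbT.
have ch := task_of_charge vt.
rewrite [explored _ _ _ _ _ _ _ _ _ _ _ _ _ _ N.+1 _ _ _]/= ltnNge ch /=.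
rewrite task_of_site lookup_label_of tl.
case: t vt tl {inv ch} => s [x|e] vt tl; last first.
  have /andP[ss e0n] : (s < sig)%N && (0 < e < n)%N by [].
  have := contour_src C e0n; rewrite /token_site /= big_seq1 /=.
  case: (mu (src e) w) => [k|] // _ Ex.
  by exists (jump (src e) (st s e)) => //; rewrite mul_jump; move: Ex;
    rewrite (ltn_eqF ss) /= mulr1.
have /andP[ss px] : (s <= sig)%N && (x \in path_sites s) by [].
case: (eqVneq s sig) => [es|ns]; last first.
  rewrite /token_site /= (negbTE ns); case: (mu x w) => [k|] /=; last first.
    by rewrite big_nil !mulr1.
  rewrite big_seq1 /= (negbTE ns) /= mulr1 => Ex.
  by exists (jump x (nx s x)) => //; rewrite mul_jump.
move: px vt; rewrite {}es {ss} => px vt.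
have -> : task_of (sig, inl x) = Back x by rewrite /= eqxx.
have -> : move_weight (sig, inl x) = 1 by rewrite /= eqxx.
rewrite mul1r; case: eqP => [->|/eqP xo].
  by rewrite (children_back_root C) big_nil mulr1.
have [[e en xE]|[y [py vy xE]]] := path_pred C (leqnn _) px.
  have e0n : (0 < e < n)%N.
    rewrite en andbT lt0n; apply: contraNneq xo => e0.
    by rewrite xE e0 (contour_root C).
  rewrite xE (children_back_st C e0n) => Ex; right; exists (jump (src e) (st sig e)) => //.
  move: Ex; rewrite mul_inv_jump -map_comp /comp /= big_map.
  have -> : iota 0 sig = 0%N :: iota 1 sig.-1.
    by rewrite -[in LHS](prednK (contour_charges C)).
  rewrite big_cons /= big_seq big1 ?mulr1 // => s'.
  by rewrite mem_iota => /andP[]; case: s'.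
rewrite xE (children_back_nx C py vy) big_seq1 /= eqxx vy => Ex.
by left; exists (jump y (nx sig y)) => //; rewrite mul_inv_jump.
Qed.

Hypothesis good_end : forall lab V, run_inv lab V [::] ->
  good_leaf r p c0 (label_of lab) (run_weight lab V [::]).

(** The contour selects one branch of every union, and the labels revealed are those of [w], so [w]
    lies in the cylinder at the leaf. The number of moves depends on the contour, hence on [w]. *)
Lemma explored_run_inv lab V todo : run_inv lab V todo ->
  exists N, explored_run lab V todo N.
Proof.
have [k] := ubnP (run_measure sig nx n Q st lab V).
elim: k lab V todo => // k IH lab V [|t td] le_k inv.
  by exists 1%N; rewrite /= good_end //=; apply/allP => q /mapP[q' _ ->] /=.
have vt : valid t by apply: (run_valid inv); rewrite mem_cat mem_head orbT.
have ch := task_of_charge vt.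
case: (boolP (token_site t \in unzip1 lab)) => tl.
  have inv' := run_inv_move C inv tl.
  have [N EN] : exists N, explored_run lab (t :: V) (children t ++ td) N.
    apply: IH => //; have [/= szV _] := run_size inv'.
    by move: le_k; rewrite /run_measure /=; lia.
  by exists N.+1; apply: explored_move.
set lab' := (token_site t, token_type t) :: lab.
pose todo' := if v (token_site t) then t :: td else t :: (sig, inl (token_site t)) :: td.
have inv' : run_inv lab' V todo'.
  rewrite /todo'; case: ifP => vs; first exact: run_inv_reveal.
  by apply: (run_inv_sink C) => //; rewrite vs.
have [N EN] : exists N, explored_run lab' V todo' N.
  apply: IH => //; have [_ /= szl] := run_size inv'.
  by move: le_k; rewrite /run_measure /=; lia.
exists N.+1; rewrite [explored _ _ _ _ _ _ _ _ _ _ _ _ _ _ N.+1 _ _ _]/= ltnNge ch /=.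
rewrite task_of_site lookup_label_of (negbTE tl).
exists (v (token_site t)) => //; move: EN; rewrite /todo' /lab'.
have -> : run_weight lab' V todo' =
    run_weight lab V (t :: td) * label_weight ph rh (token_type t) (v (token_site t)).
  rewrite /run_weight /lab' big_cons /= /todo'.
  set a := \prod_(q <- lab) _; set b := \prod_(j <- V) move_weight j.
  case vs: (mu (token_site t) w) => [l|] /=; first by ring.
  rewrite !big_cat !big_cons /= vs /= andbF; ring.
case vs: (mu (token_site t) w) => [l|] /=; first by rewrite vs task_of_type.
by rewrite vs eqxx.
Qed.

End GhostWeight.

(** * Completed explorations *)

Section CompletedRun.
Context (G : cgroup) (m : nat) (v : G -> option 'I_m) (sig : nat) (o : G)
  (h : G -> int) (nx : nat -> G -> G) (n Q : nat) (src : nat -> G)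
  (st : nat -> nat -> G).
Hypothesis C : is_contour v sig o h nx n Q src st.

Notation token := (token G).
Notation valid := (valid sig nx n Q st).
Notation children := (children v sig nx n Q st).
Notation path_sites := (path_sites nx n Q st).
Notation token_site := (token_site src).

Variables (lab : seq (G * option nat)) (V : seq token).
Hypothesis inv : run_inv v sig o nx n Q src st lab V [::].

Local Open Scope nat_scope.

Lemma run_endE t : (t \in V) = (t \in root_tokens v sig o lab) || (t \in flatten (map children V)).
Proof. by rewrite -mem_cat -(perm_mem (run_perm inv)) cats0. Qed.

Lemma run_end_valid t : t \in V -> valid t.
Proof. by move=> tV; apply: (run_valid inv); rewrite cats0. Qed.

Lemma run_end_children t t' : t \in V -> t' \in children t -> t' \in V.
Proof. by move=> tV t'c; rewrite run_endE; apply/orP; right; apply/flatten_mapP; exists t. Qed.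

Lemma run_end_fwd_root s : s < sig -> (s, inl o) \in V.
Proof. by move=> ss; rewrite run_endE !mem_cat map_f // mem_iota. Qed.

Lemma run_end_sink x : ~~ v x -> ((sig, inl x) \in V) = (x \in unzip1 lab).
Proof.
move=> vx; rewrite run_endE mem_cat -orbA; apply/or3P/idP => [[]|/mapP[q ql xE]].
- by case/mapP=> s; rewrite mem_iota => /= ss [e _]; move: ss; rewrite -e add0n ltnn.
- by case/mapP=> q; rewrite mem_filter => /andP[_ ql] [->]; apply: map_f.
- case/flatten_mapP=> t tV /(children_backP C (run_end_valid tV))[_ _ vx'].
  by rewrite vx' in vx.
- apply: Or32; apply/mapP; exists q; rewrite ?mem_filter -?xE //.
  by rewrite vx ql.
Qed.

(** The exploration covers a path entirely or not at all: in one direction because tokens in [V] are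
    processed, in the other because a token that is no root has a unique parent. *)
Lemma run_end_nx s y : s <= sig -> y \in path_sites s -> v y ->
  ((s, inl (nx s y)) \in V) = ((s, inl y) \in V).
Proof.
rewrite leq_eqVlt => /predU1P[->|ss] py vy; apply/idP/idP.
- move=> nV; apply: run_end_children nV _.
  by rewrite (children_back_nx C) // mem_head.
- rewrite run_endE mem_cat -orbA => /or3P[||].
  + by case/mapP=> s'; rewrite mem_iota => /= ss [e _]; move: ss; rewrite -e add0n ltnn.
  + by case/mapP=> q; rewrite mem_filter => /andP[nv _] [yE]; rewrite -yE vy in nv.
  + by case/flatten_mapP=> t tV /(children_backP C (run_end_valid tV))[<-].
- rewrite run_endE mem_cat -orbA => /or3P[||].
  + case/mapP=> s' _ [_ E]; case: (nx_st C (ltnW ss) py vy (contour_sources C)).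
    by rewrite (contour_root C).
  + by case/mapP=> q _ [e _]; move: ss; rewrite e ltnn.
  + case/flatten_mapP=> t tV /(children_fwdP C ss (run_end_valid tV))[].
      case=> y' [tE py' vy' E]; rewrite (nx_inj C (ltnW ss) py py' vy vy' E).
      by rewrite -tE.
    by case=> e [_ /andP[_ en] E]; case: (nx_st C (ltnW ss) py vy en).
- move=> yV; apply: run_end_children yV _.
  by rewrite /= (ltn_eqF ss) vy mem_head.
Qed.

Lemma run_end_st s e : s < sig -> 0 < e < n ->
  ((s, inl (st s e)) \in V) = ((sig, inl (st sig e)) \in V).
Proof.
move=> ss e0n; have /andP[e0 en] := e0n; apply/idP/idP; last first.
  move=> eV; apply: (@run_end_children (s, inr e)); last by rewrite /= mem_head.
  by apply: run_end_children eV _; rewrite (children_back_st C) // map_f // mem_iota.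
rewrite run_endE mem_cat -orbA => /or3P[||].
- case/mapP=> s' _ [_]; rewrite -(contour_root C s).
  move=> /(st_inj C (ltnW ss) en (contour_sources C)) e00.
  by rewrite e00 in e0.
- by case/mapP=> q _ [e' _]; move: ss; rewrite e' ltnn.
- case/flatten_mapP=> t tV /(children_fwdP C ss (run_end_valid tV))[].
    by case=> y [_ py vy] /esym/(nx_st C (ltnW ss) py vy en).
  case=> e' [tE /andP[_ e'n] /(st_inj C (ltnW ss) en e'n) ee].
  move: tV; rewrite tE -{}ee run_endE mem_cat -orbA => /or3P[/mapP[]|/mapP[]|] //.
  case/flatten_mapP=> t' t'V /(children_srcP C (run_end_valid t'V))[E _ _].
  by rewrite -E.
Qed.

Definition end_steps s := [seq x <- undup (path_sites s) | ((s, inl x) \in V) && v x].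
Definition end_arrivals s := [seq x <- undup (path_sites s) | ((s, inl x) \in V) && ~~ v x].
Definition end_starts s := [seq e <- iota 0 n | (s, inl (st s e)) \in V].
Definition end_sinks := [seq q.1 | q <- lab & ~~ v q.1].

Lemma end_stepsE s x : s <= sig -> (x \in end_steps s) = ((s, inl x) \in V) && v x.
Proof.
move=> ss; rewrite mem_filter mem_undup; apply/andb_idr => /andP[xV _].
by have /andP[] := run_end_valid xV.
Qed.

Lemma end_arrivalsE s x : s <= sig -> (x \in end_arrivals s) = ((s, inl x) \in V) && ~~ v x.
Proof.
move=> ss; rewrite mem_filter mem_undup; apply/andb_idr => /andP[xV _].
by have /andP[] := run_end_valid xV.
Qed.

Lemma end_path s x : (s, inl x) \in V -> x \in path_sites s.
Proof. by move=> /run_end_valid /andP[]. Qed.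

(** The explored sites of one charge are listed twice: by whether they are left again, and by how
    they are entered, through a step or as a start. *)
Lemma end_flow s : s <= sig ->
  perm_eq (end_steps s ++ end_arrivals s)
          (map (nx s) (end_steps s) ++ map (st s) (end_starts s)).
Proof.
move=> ss; apply: uniq_perm.
- rewrite cat_uniq !filter_uniq ?undup_uniq //= andbT; apply/hasPn => x.
  by rewrite end_arrivalsE // => /andP[_ nv]; rewrite /= end_stepsE // (negbTE nv) andbF.
- rewrite cat_uniq !map_inj_in_uniq ?filter_uniq ?undup_uniq ?iota_uniq ?andbT //.
  + apply/hasPn => x /mapP[e]; rewrite mem_filter mem_iota => /andP[_ /= en] ->.
    apply/negP => /mapP[y]; rewrite end_stepsE // => /andP[yV vy].
    by move=> /esym/(nx_st C ss (end_path yV) vy en).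
  + by move=> e e' /[!mem_filter] /[!mem_iota] /andP[_ /= en] /andP[_ /= e'n]; apply: (st_inj C).
  + move=> y y' /[!end_stepsE] // /andP[yV vy] /andP[y'V vy'].
    by apply: (nx_inj C); rewrite ?(end_path yV) ?(end_path y'V).
move=> x; rewrite !mem_cat end_stepsE // end_arrivalsE // -andb_orr orbN andbT.
apply/idP/orP => [xV|[/mapP[y] + ->|/mapP[e] + ->]].
- have [[e en xE]|[y [py vy xE]]] := path_pred C ss (end_path xV).
    by right; rewrite xE; apply: map_f; rewrite mem_filter -xE xV mem_iota.
  left; rewrite xE; apply: map_f; rewrite end_stepsE // vy andbT.
  by rewrite -run_end_nx // -xE.
- by rewrite end_stepsE // => /andP[yV vy]; rewrite run_end_nx ?(end_path yV).
- by rewrite mem_filter => /andP[].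
Qed.

Lemma size_end_arrivals s : s <= sig -> size (end_arrivals s) = size (end_starts s).
Proof.
by move=> /end_flow /perm_size; rewrite !size_cat !size_map => /addnI.
Qed.

Lemma uniq_end_sinks : uniq end_sinks.
Proof.
apply: (subseq_uniq _ (run_lab inv)); apply: map_subseq; exact: filter_subseq.
Qed.

Lemma end_sinksE x : (x \in end_sinks) = (x \in unzip1 lab) && ~~ v x.
Proof.
apply/mapP/andP => [[q]|[/mapP[q ql ->] vq]].
  by rewrite mem_filter => /andP[vq ql] ->; split; first exact: map_f.
by exists q; rewrite // mem_filter vq.
Qed.

Lemma end_sinks_arrivals : perm_eq end_sinks (end_arrivals sig).
Proof.
apply: uniq_perm; rewrite ?uniq_end_sinks ?filter_uniq ?undup_uniq // => x.
rewrite end_sinksE end_arrivalsE //; apply/andb_id2r => vx; exact/esym/run_end_sink.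
Qed.

Lemma end_arrivals_sub s : s <= sig -> {subset end_arrivals s <= end_sinks}.
Proof.
move=> ss x; rewrite end_arrivalsE // end_sinksE => /andP[xV ->].
by rewrite (run_seen inv xV).
Qed.

(* Counting: each forward charge brings as many arrivals as there are sources,
   all at revealed sinks, whereas the backward charge leads from the revealed
   sinks to different sources; hence all these inequalities are equalities. *)
Lemma end_starts_eq s : s <= sig -> end_starts s = end_starts sig /\ 0 \in end_starts sig.
Proof.
have sub s' : s' < sig -> {subset end_starts sig <= end_starts s'}.
  move=> ss e; rewrite !mem_filter => /andP[eV en]; rewrite en andbT.
  case: (posnP e) => [->|e0]; first by rewrite (contour_root C) run_end_fwd_root.
  by rewrite run_end_st // e0; move: en; rewrite mem_iota.
have eqm s' : s' < sig -> end_starts sig =i end_starts s'.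
  move=> ss; have [|_ eqs] := uniq_min_size (filter_uniq _ (iota_uniq 0 n)) (sub s' ss); last exact: eqs.
  rewrite -size_end_arrivals ?(ltnW ss) // -size_end_arrivals //.
  rewrite -(perm_size end_sinks_arrivals); apply: uniq_leq_size.
    by rewrite filter_uniq ?undup_uniq.
  exact: end_arrivals_sub (ltnW ss).
have mem0 : 0 \in end_starts sig.
  rewrite (eqm 0 (contour_charges C)) mem_filter (contour_root C).
  by rewrite run_end_fwd_root ?(contour_charges C) // mem_iota (contour_sources C).
rewrite leq_eqVlt => /predU1P[->|ss]; split=> //.
apply: eq_in_filter => e en; have := eqm s ss e.
by rewrite !mem_filter en !andbT.
Qed.

Lemma end_arrivals_perm s : s <= sig -> perm_eq (end_arrivals s) end_sinks.
Proof.
move=> ss; apply: uniq_perm; rewrite ?uniq_end_sinks ?filter_uniq ?undup_uniq //.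
have [|_ eqs] := uniq_min_size (filter_uniq _ (undup_uniq (path_sites s))) (end_arrivals_sub ss); last exact: eqs.
rewrite size_end_arrivals // (end_starts_eq ss).1 -size_end_arrivals //.
by rewrite (perm_size end_sinks_arrivals).
Qed.

Definition end_forks := [seq e <- iota 1 n.-1 | (sig, inl (st sig e)) \in V].

Lemma end_startsE s : s <= sig -> end_starts s = 0 :: end_forks.
Proof.
move=> ss; have [-> ] := end_starts_eq ss; rewrite /end_starts /end_forks.
rewrite -[in iota 0 n](prednK (contour_sources C)) /=.
by case: ifP => // _; rewrite mem_filter mem_iota andbF.
Qed.

Lemma end_forksE e : (e \in end_forks) = (0 < e < n) && ((sig, inl (st sig e)) \in V).
Proof. by rewrite mem_filter mem_iota add1n prednK ?(contour_sources C) // andbC. Qed.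

Lemma end_balance s : s <= sig ->
  perm_eq (end_steps s ++ end_sinks)
          (map (nx s) (end_steps s) ++ map (st s) (0 :: end_forks)).
Proof.
move=> ss; rewrite -(end_startsE ss); apply: perm_trans (end_flow ss).
by rewrite perm_cat2l perm_sym end_arrivals_perm.
Qed.

Lemma run_end_src s e : ((s, inr e) \in V) = (s < sig) && (e \in end_forks).
Proof.
apply/idP/andP => [eV|[ss]]; last first.
  rewrite end_forksE => /andP[e0n eV]; apply: run_end_children eV _.
  by rewrite (children_back_st C) // map_f // mem_iota.
have /andP[ss e0n] := run_end_valid eV; split=> //; rewrite end_forksE e0n /=.
move: eV; rewrite run_endE mem_cat -orbA => /or3P[/mapP[]|/mapP[]|] //.
by case/flatten_mapP=> t tV /(children_srcP C (run_end_valid tV))[<-].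
Qed.

Lemma run_end_inl s x : ((s, inl x) \in V) = (s <= sig) && (x \in end_steps s ++ end_sinks).
Proof.
apply/idP/andP => [xV|[ss]].
  have /andP[ss _] := run_end_valid xV; split=> //.
  rewrite mem_cat -(perm_mem (end_arrivals_perm ss)) end_stepsE // end_arrivalsE //.
  by rewrite xV orbN.
rewrite mem_cat -(perm_mem (end_arrivals_perm ss)) end_stepsE // end_arrivalsE //.
by rewrite -andb_orr => /andP[].
Qed.

Lemma end_perm : perm_eq V
  ([seq (s, inl x) | s <- iota 0 sig.+1, x <- end_steps s ++ end_sinks] ++
   [seq (s, inr e) | s <- iota 0 sig, e <- end_forks]).
Proof.
apply: uniq_perm.
- by have := run_uniq inv; rewrite cats0.
- rewrite cat_uniq; apply/and3P; split.
  + apply: allpairs_uniq_dep; rewrite ?iota_uniq //.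
      move=> s _; rewrite cat_uniq filter_uniq ?undup_uniq ?uniq_end_sinks // andbT /=.
      apply/hasPn => x; rewrite end_sinksE => /andP[_ nv] /=.
      by rewrite mem_filter (negbTE nv) andbF.
    by move=> [s x] [s' x'] _ _ [-> ->].
  + by apply/hasPn => t /allpairsP[[s e] [_ _ ->]]; apply/negP => /allpairsPdep[s' [x [_ _]]].
  + by rewrite allpairs_uniq ?iota_uniq ?filter_uniq ?iota_uniq // => -[s e] [s' e'] _ _ [-> ->].
case=> s [x|e]; rewrite mem_cat.
- rewrite run_end_inl; apply/andP/orP => [[ss xs]|[|]].
  + by left; apply/allpairsPdep; exists s, x; split; rewrite ?mem_iota.
  + by case/allpairsPdep=> s' [x' [+ ? [-> ->]]]; rewrite mem_iota; split.
  + by case/allpairsP=> -[s' e] [].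
- rewrite run_end_src; apply/andP/orP => [[ss xs]|[|]].
  + by right; apply/allpairsP; exists (s, e); split; rewrite ?mem_iota.
  + by case/allpairsPdep=> s' [x' []].
  + by case/allpairsP=> -[s' e'] [+ ? [-> ->]]; rewrite mem_iota; split.
Qed.

Lemma end_lab_type x t : (x, t) \in lab -> v x ->
  (exists s, [/\ t = Some s, s <= sig & x \in end_steps s]) \/
  (exists2 e, t = None & e \in end_forks /\ x = src e).
Proof.
move=> /(run_type inv)[[s [y|e]]]; rewrite cats0 => tV [-> ->] /= vx.
  by left; exists s; have /andP[ss _] := run_end_valid tV; rewrite end_stepsE // tV vx.
by right; exists e => //; split=> //; move: tV; rewrite run_end_src => /andP[].
Qed.

Lemma end_steps_lab s x : s <= sig -> x \in end_steps s -> x \in unzip1 lab.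
Proof. by move=> ss; rewrite end_stepsE // => /andP[/(run_seen inv)]. Qed.

Local Open Scope ring_scope.

(** The right-hand side sees the charge only through the starts [st s e]. With [F] the height this
    counts steps; with [F] a component of [L] it yields the cancellation. *)
Lemma end_telescope (U : zmodType) (F : G -> U) s : (s <= sig)%N ->
  \sum_(x <- end_steps s) (F (nx s x) - F x) =
  \sum_(x <- end_sinks) F x - F o - \sum_(e <- end_forks) F (st s e).
Proof.
move=> ss; rewrite sumrB.
have E : \sum_(x <- end_steps s) F x + \sum_(x <- end_sinks) F x =
    \sum_(x <- end_steps s) F (nx s x) + (F o + \sum_(e <- end_forks) F (st s e)).
  by rewrite -big_cat (perm_big _ (end_balance ss)) big_cat !big_map big_cons (contour_root C).
have -> : \sum_(x <- end_sinks) F x = \sum_(x <- end_steps s) F (nx s x) +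
    (F o + \sum_(e <- end_forks) F (st s e)) - \sum_(x <- end_steps s) F x.
  by rewrite -E addrAC subrr add0r.
by rewrite -addrA -opprD addrAC addrK.
Qed.

End CompletedRun.

(** * Weights of completed explorations *)

Lemma prod_seqM (R : comPzRingType) (T : Type) (l : seq T) (c : R) (f : T -> R) :
  \prod_(x <- l) (c * f x) = c ^+ size l * \prod_(x <- l) f x.
Proof.
elim: l => [|x l IH]; first by rewrite !big_nil mulr1.
by rewrite !big_cons IH /= exprS mulrACA.
Qed.

Lemma ler_prod_seq (R : numDomainType) (T : eqType) (l : seq T) (f g : T -> R) :
  (forall x, x \in l -> 0 <= f x <= g x) ->
  0 <= \prod_(x <- l) f x <= \prod_(x <- l) g x.
Proof.
move=> fg; rewrite ![in X in _ <= X <= _]big_seq ![in X in _ <= _ <= X]big_seq.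
rewrite prodr_ge0 /= => [|x xl]; last by case/andP: (fg x xl).
by apply: ler_prod => x xl; apply: fg.
Qed.

(* The last charge is weighted by the full constant g, which distributes the
   factors gamma s over the equally long lists l s of all charges. *)
Lemma charge_weight_bound (R : realDomainType) (T : eqType) (sig k : nat)
    (l : nat -> seq T) (a e : nat -> T -> R) (t : T -> R) (gamma : nat -> R) (kappa g : R) :
  g = kappa * \prod_(s < sig.+1) gamma s -> 0 <= kappa ->
  (forall s, (s <= sig)%N -> 0 <= gamma s) ->
  (forall s, (s <= sig)%N -> size (l s) = k) ->
  (forall s x, (s <= sig)%N -> x \in l s -> 0 <= a s x) ->
  (forall s x, (s <= sig)%N -> x \in l s -> 0 <= e s x <= gamma s * a s x) ->
  (forall x, x \in l sig -> a sig x <= t x) ->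
  kappa ^+ k * \prod_(s < sig.+1) \prod_(x <- l s) e s x <=
  (\prod_(s < sig) \prod_(x <- l s) a s x) * \prod_(x <- l sig) (g * t x).
Proof.
move=> gE k0 ga0 szl a0 ea at_.
have gam0 : 0 <= \prod_(s < sig.+1) gamma s.
  by apply: prodr_ge0 => s _; apply: ga0; rewrite -ltnS.
have g0 : 0 <= g by rewrite gE mulr_ge0.
have le1 : \prod_(x <- l sig) (g * a sig x) <= \prod_(x <- l sig) (g * t x).
  have /andP[_ //] : 0 <= \prod_(x <- l sig) (g * a sig x) <= \prod_(x <- l sig) (g * t x).
  apply: ler_prod_seq => x xl.
  by rewrite mulr_ge0 ?a0 //= ler_wpM2l // at_.
have pa0 : 0 <= \prod_(s < sig) \prod_(x <- l s) a s x.
  apply: prodr_ge0 => s _; rewrite big_seq; apply: prodr_ge0 => x xl.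
  by apply: a0 xl; apply: ltnW.
apply: le_trans (ler_wpM2l pa0 le1).
have -> : (\prod_(s < sig) \prod_(x <- l s) a s x) * \prod_(x <- l sig) (g * a sig x) =
    kappa ^+ k * \prod_(s < sig.+1) \prod_(x <- l s) (gamma s * a s x).
  transitivity (kappa ^+ k * \prod_(s < sig.+1) (gamma s ^+ k * \prod_(x <- l s) a s x)).
    rewrite prod_seqM szl // gE exprMn -prodrXl big_split [X in _ = _ * (_ * X)]big_ord_recr /=.
    ring.
  congr (_ * _); apply: eq_bigr => -[s /=]; rewrite ltnS => ss _.
  by rewrite prod_seqM szl.
rewrite ler_wpM2l ?exprn_ge0 //.
apply: ler_prod => -[s /=]; rewrite ltnS => ss _.
by apply: ler_prod_seq => x xl; apply: ea.
Qed.

Section EndWeight.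
Context (R : realType) (G : cgroup) (m : nat) (sig : nat) (o : G)
  (h : G -> int) (nx : nat -> G -> G) (n Q : nat) (src : nat -> G)
  (st : nat -> nat -> G) (d : measure_display)
  (Omega : measurableType d) (mu : G -> Omega -> option 'I_m) (w : Omega).
Local Notation v := (fun i => mu i w).
Hypothesis C : is_contour v sig o h nx n Q src st.
Variables (lab : seq (G * option nat)) (V : seq (token G)).
Hypothesis inv : run_inv v sig o nx n Q src st lab V [::].

Variables (r : 'I_m -> R) (p ph : R) (rh : option nat -> 'I_m -> R)
  (abul acirc : nat -> 'I_m -> G -> R) (gb gc : R) (sb sc : G -> R) (c0 : R).
Variables (lam : R) (L : nat -> G -> R) (A : nat -> 'I_m -> set G)
  (Delta : 'I_m -> set G) (bs : nat -> 'I_m -> R) (gB gC : nat -> R) (delta : R).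

Notation D := (end_steps v nx n Q st V).
Notation N := (end_sinks v lab).
Notation X := (end_forks sig n st V).

Definition step_value (f : 'I_m -> R) (x : G) : R := if v x is Some k then f k else 1.

Lemma prod_run (f : token G -> R) :
  \prod_(t <- V) f t =
  (\prod_(s < sig.+1) ((\prod_(x <- D s) f (s : nat, inl x)) * \prod_(x <- N) f (s : nat, inl x))) *
  \prod_(s < sig) \prod_(e <- X) f (s : nat, inr e).
Proof.
rewrite (perm_big _ (end_perm C inv)) big_cat; congr (_ * _).
  rewrite big_allpairs_dep -[iota _ _]/(index_iota 0 sig.+1) big_mkord.
  by apply: eq_bigr => s _; rewrite big_cat.
by rewrite big_allpairs_dep -[sig in iota 0 sig]subn0 -/(index_iota 0 sig) big_mkord.
Qed.

Definition bul_weight s x := step_value (fun k => abul s k (jump x (nx s x))) x.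
Definition circ_weight s e := step_value (fun k => acirc s k (jump (src e) (st s e))) (src e).

Lemma prod_move_weight : \prod_(t <- V) move_weight sig nx src st mu w abul acirc t =
  (\prod_(s < sig) \prod_(x <- D s) bul_weight s x) *
  \prod_(s < sig) \prod_(e <- X) circ_weight s e.
Proof.
rewrite prod_run; congr (_ * _); rewrite big_ord_recr /= eqxx !big1_eq !mulr1.
apply: eq_bigr => s _; rewrite (ltn_eqF (ltn_ord s)) [X in _ * X]big_seq [X in _ * X]big1 ?mulr1 //.
by move=> x; rewrite end_sinksE => /andP[_]; case: (mu x w).
Qed.

Lemma prod_push_weight : \prod_(t <- V) push_weight sig nx src st mu w gb gc sb sc t =
  (\prod_(x <- D sig) (gb * sb (jump x (nx sig x)))) *
  \prod_(e <- X) (gc * sc (jump (src e) (st sig e))).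
Proof.
have sig0 := contour_charges C.
rewrite prod_run; congr (_ * _).
  rewrite big_ord_recr /= big1 ?mul1r => [|s _]; last first.
    by rewrite (ltn_eqF (ltn_ord s)) !big1_eq mulr1.
  rewrite eqxx /= [X in _ * X]big_seq [X in _ * X]big1 ?mulr1 => [|x]; last first.
    by rewrite end_sinksE => /andP[_]; case: (mu x w).
  rewrite big_seq [RHS]big_seq; apply: eq_bigr => x.
  by rewrite (end_stepsE inv) // => /andP[_ ->].
case: sig sig0 => // sig' _; rewrite big_ord_recl /= [X in _ * X]big1 ?mulr1 // => s _.
by rewrite big1_eq.
Qed.

End EndWeight.

Section GoodEnd.
Context (R : realType) (G : cgroup) (m : nat) (sig : nat) (o : G)
  (h : G -> int) (nx : nat -> G -> G) (n Q : nat) (src : nat -> G)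
  (st : nat -> nat -> G) (d : measure_display)
  (Omega : measurableType d) (mu : G -> Omega -> option 'I_m) (w : Omega).
Local Notation v := (fun i => mu i w).
Hypothesis C : is_contour v sig o h nx n Q src st.
Variables (lab : seq (G * option nat)) (V : seq (token G)).
Hypothesis inv : run_inv v sig o nx n Q src st lab V [::].

Variables (r : 'I_m -> R) (p ph : R) (rh : option nat -> 'I_m -> R)
  (abul acirc : nat -> 'I_m -> G -> R) (gb gc : R) (sb sc : G -> R).
Variables (lam : R) (L : nat -> G -> R) (A : nat -> 'I_m -> set G)
  (Delta : 'I_m -> set G) (bs : nat -> 'I_m -> R) (gB gC : nat -> R) (delta : R).

Notation D := (end_steps v nx n Q st V).
Notation N := (end_sinks v lab).
Notation X := (end_forks sig n st V).
Notation path_sites := (path_sites nx n Q st).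

Hypothesis jump_bul : forall s y k, (s <= sig)%N -> y \in path_sites s ->
  v y = Some k -> A s k (jump y (nx s y)).
Hypothesis jump_circ : forall s e k, (s <= sig)%N -> (0 < e < n)%N ->
  v (src e) = Some k -> Delta k (jump (src e) (st s e)).

Hypothesis p01 : 0 <= p <= 1.
Hypothesis ph01 : 0 < ph < 1.
Hypothesis r_ge0 : forall k, 0 <= r k.
Hypothesis rh_ge0 : forall t k, (odflt 0%N t <= sig)%N -> 0 <= rh t k.
Hypothesis rh_circE : rh None = r.
Hypothesis abul_ge0 : forall s k j, (s <= sig)%N -> 0 <= abul s k j.
Hypothesis acirc_ge0 : forall s k j, (s <= sig)%N -> 0 <= acirc s k j.
Hypothesis bs_ge0 : forall s k, 0 <= bs s k.
Hypothesis gB_ge0 : forall s, (s <= sig)%N -> 0 <= gB s.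
Hypothesis gC_ge0 : forall s, (s <= sig)%N -> 0 <= gC s.
Hypothesis sbE : forall k j, abul sig k j <= sb j.
Hypothesis scE : forall k j, acirc sig k j <= sc j.
Hypothesis bul_bound : forall s k j, (s <= sig)%N -> A s k j ->
  expR (- lam * L s j) * bs s k <= gB s * abul s k j.
(** At [p = 0] the constants for forks may be infinite, so they are controlled only for positive
    [p]. *)
Hypothesis circ_bound : p != 0 -> forall s k j, (s <= sig)%N -> Delta k j ->
  expR (- lam * L s j) <= gC s * acirc s k j.
Hypothesis gbE : gb = (1 - ph) ^- sig.+1 * \prod_(s < sig.+1) gB s.
Hypothesis gcE : p != 0 -> gc = p / (ph * (1 - ph)) / delta * \prod_(s < sig.+1) gC s.
Hypothesis delta01 : 0 < delta <= 1.
(** [S] is the set of charges that step out of the site. This bound serves sites first visited as a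
    source, the next one sites first reached by charge [s0]. *)
Hypothesis delta_bound : forall k (S : pred nat),
  delta <= \prod_(s < sig.+1) (if S s then bs s k else 1).
Hypothesis beta_bound : forall k s0 (S : pred nat), (s0 <= sig)%N -> S s0 ->
  r k <= rh (Some s0) k * \prod_(s < sig.+1) (if S s then bs s k else 1).
Hypothesis L_morph : forall s i j, (s <= sig)%N -> L s (cg_mul i j) = L s i + L s j.
Hypothesis L_polar : forall i, \sum_(s < sig.+1) L s i = 0.

Lemma L_jump s x y : (s <= sig)%N -> L s (jump x y) = L s y - L s x.
Proof. by move=> ss; rewrite -[in L s y](mul_jump x y) L_morph // addrAC subrr add0r. Qed.

Lemma size_end_sinks : size N = (size X).+1.
Proof.
have /perm_size := end_balance C inv (leqnn sig).
by rewrite !size_cat !size_map /= => /addnI.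
Qed.

(** A step raises [h] by one and every fork start lies one level above its fork, so telescoping [h]
    expresses the number of steps through defects, root and forks, which all charges share. *)
Lemma size_end_steps s : (s <= sig)%N -> size (D s) = size (D sig).
Proof.
have E s' : (s' <= sig)%N -> ((size (D s'))%:Z = \sum_(x <- N) h x - h o -
    \sum_(e <- X) (h (src e) + 1))%R.
  move=> ss; have := end_telescope C inv h ss.
  rewrite [X in X = _](_ : _ = (size (D s'))%:Z).
    move=> ->; congr (_ - _); rewrite big_seq [RHS]big_seq; apply: eq_bigr => e.
    by rewrite (end_forksE C) => /andP[e0n _]; rewrite (contour_src_height C).
  rewrite big_seq (eq_bigr (fun=> 1)) => [|x].
    by rewrite -big_seq big_const_seq count_predT iter_addr addr0 -natz.
  rewrite (end_stepsE inv) // => /andP[xV vx].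
  by rewrite (contour_height C ss (end_path inv xV) vx) addrAC subrr add0r.
by move=> ss; have := E s ss; rewrite -(E sig (leqnn _)) => -[].
Qed.

Definition bul_factor s x := expR (- lam * L s (jump x (nx s x))).
Definition circ_factor s e := expR (- lam * L s (jump (src e) (st s e))).

(** Adding the displacement out of each fork to the telescoped sum of [L s] replaces [st s e] by
    [src e]. What remains is evaluated at sites common to all charges, where the sum over [s]
    vanishes. *)
Lemma prod_polar : (\prod_(s < sig.+1) \prod_(x <- D s) bul_factor s x) *
  \prod_(s < sig.+1) \prod_(e <- X) circ_factor s e = 1.
Proof.
rewrite -big_split /= (eq_bigr (fun s : 'I_sig.+1 => expR (- lam *
    (\sum_(x <- N) L s x - L s o - \sum_(e <- X) L s (src e))))).
  rewrite -expR_sum -mulr_sumr !sumrB exchange_big /= (eq_bigr (fun=> 0)) => [|x _].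
    rewrite big1 // L_polar subr0 exchange_big /= big1 => [|e _]; last exact: L_polar.
    by rewrite subr0 mulr0 expR0.
  exact: L_polar.
move=> [s /=]; rewrite ltnS => ss _; rewrite -!expR_sum -expRD -!mulr_sumr -mulrDr.
congr (expR (_ * _)).
rewrite (eq_bigr (fun x => L s (nx s x) - L s x)) => [|x _]; last exact: L_jump.
rewrite (end_telescope C inv _ ss) [X in _ + X](eq_bigr (fun e => L s (st s e) - L s (src e))).
  by rewrite sumrB addrA subrK.
by move=> e _; rewrite L_jump.
Qed.

Definition step_bs s x := step_value mu w (bs s) x.

Lemma bul_part : (1 - ph) ^- (sig.+1 * size (D sig)) *
    \prod_(s < sig.+1) \prod_(x <- D s) (bul_factor s x * step_bs s x) <=
  (\prod_(s < sig) \prod_(x <- D s) bul_weight nx mu w abul s x) *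
  \prod_(x <- D sig) (gb * sb (jump x (nx sig x))).
Proof.
have q0 : 0 < 1 - ph by case/andP: ph01; rewrite subr_gt0.
rewrite exprM -exprVn.
apply: (charge_weight_bound (l := fun s => D s) (a := bul_weight nx mu w abul)
  (e := fun s x => bul_factor s x * step_bs s x)
  (t := fun x => sb (jump x (nx sig x))) gbE _ gB_ge0 size_end_steps).
- by rewrite invr_ge0 exprn_ge0 // ltW.
- by move=> s x ss _; rewrite /bul_weight /step_value; case: (mu x w) => // k; apply: abul_ge0.
- move=> s x ss; rewrite (end_stepsE inv) // => /andP[xV].
  rewrite /bul_weight /step_bs /step_value /bul_factor.
  have := @jump_bul s x; case: (mu x w) => // k jA _.
  rewrite mulr_ge0 ?expR_ge0 //=; apply: bul_bound => //; apply: jA => //.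
  exact: (end_path inv xV).
- move=> x; rewrite (end_stepsE inv) // => /andP[xV].
  by rewrite /bul_weight /step_value; case: (mu x w).
Qed.

Lemma circ_part : p != 0 -> (p / (ph * (1 - ph)) / delta) ^+ size X *
    \prod_(s < sig.+1) \prod_(e <- X) circ_factor s e <=
  (\prod_(s < sig) \prod_(e <- X) circ_weight src st mu w acirc s e) *
  \prod_(e <- X) (gc * sc (jump (src e) (st sig e))).
Proof.
move=> p0; have [ph0 ph1] := andP ph01; have [p_ge0 _] := andP p01.
have [d0 _] := andP delta01.
apply: (charge_weight_bound (l := fun=> X) (a := circ_weight src st mu w acirc)
  (e := circ_factor) (t := fun e => sc (jump (src e) (st sig e))) (gcE p0) _ gC_ge0) => //.
- by rewrite !divr_ge0 ?mulr_ge0 ?subr_ge0 // ltW.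
- by move=> s x ss _; rewrite /circ_weight /step_value; case: (mu _ w) => // k; apply: acirc_ge0.
- move=> s e ss; rewrite (end_forksE C) => /andP[e0n _]; have := contour_src C e0n.
  rewrite /circ_weight /step_value /circ_factor.
  have := @jump_circ s e; case: (mu _ w) => // k jD _.
  by rewrite expR_ge0 /=; apply: circ_bound => //; apply: jD.
- move=> e; rewrite (end_forksE C) => /andP[e0n _]; have := contour_src C e0n.
  by rewrite /circ_weight /step_value; case: (mu _ w).
Qed.

Notation LS := [seq q <- lab | v q.1].

Lemma uniq_labelled : uniq (map fst LS).
Proof. by apply: subseq_uniq (run_lab inv); apply: map_subseq; apply: filter_subseq. Qed.

Lemma labelled_type q : q \in LS ->
  (exists s, [/\ q.2 = Some s, (s <= sig)%N & q.1 \in D s]) \/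
  (q.2 = None /\ q.1 \in map src X).
Proof.
case: q => x t; rewrite mem_filter => /andP[vx xl].
have [|[e -> [eX ->]]] := end_lab_type C inv xl vx; first by left.
by right; split=> //; apply: map_f.
Qed.

Lemma size_labelled_circ : (size [seq q <- LS | q.2 == None] <= size X)%N.
Proof.
rewrite -(size_map fst) -[leqRHS](size_map src); apply: uniq_leq_size.
  by apply: subseq_uniq uniq_labelled; apply: map_subseq; apply: filter_subseq.
move=> x /mapP[q]; rewrite mem_filter => /andP[/eqP q2 ql] ->.
by have [[s [q2' _ _]]|[_ //]] := labelled_type ql; rewrite q2' in q2.
Qed.

(** Each revealed site that is no defect was first met in a step of some charge or as a fork.
    Equality fails when paths of several charges share sites. *)
Lemma size_labelled : (size LS <= sig.+1 * size (D sig) + size X)%N.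
Proof.
rewrite -(size_map fst) -[size X](size_map src).
have -> : (sig.+1 * size (D sig))%N = size (flatten [seq D s | s <- iota 0 sig.+1]).
  rewrite size_flatten /shape -map_comp sumnE big_map.
  rewrite [RHS]big_seq (eq_bigr (fun=> size (D sig))) => [|s].
    by rewrite -big_seq big_const_seq count_predT size_iota iter_addn_0 mulnC.
  by rewrite mem_iota => /andP[_ ss] /=; rewrite size_end_steps.
rewrite -size_cat; apply: uniq_leq_size uniq_labelled _ => x /mapP[q ql ->].
rewrite mem_cat; have [[s [_ ss xD]]|[_ ->]] := labelled_type ql; last by rewrite orbT.
by apply/orP; left; apply/flatten_mapP; exists s; rewrite // mem_iota.
Qed.

(** Passes from bookkeeping by sites to bookkeeping by charges; every explored step leaves a
    revealed site. *)
Lemma prod_bs :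
  \prod_(q <- LS) \prod_(s < sig.+1) (if q.1 \in D s then step_bs s q.1 else 1) =
  \prod_(s < sig.+1) \prod_(x <- D s) step_bs s x.
Proof.
rewrite exchange_big /=; apply: eq_bigr => -[s /=]; rewrite ltnS => ss _.
rewrite -[LHS](big_map fst xpredT (fun x => if x \in D s then step_bs s x else 1)).
rewrite -big_mkcond -big_filter; apply: perm_big; apply: uniq_perm.
- by rewrite filter_uniq // uniq_labelled.
- by rewrite filter_uniq ?undup_uniq.
move=> x; rewrite mem_filter; apply: andb_idr => xD.
have /mapP[q ql xq] := end_steps_lab inv ss xD; apply/mapP; exists q => //.
by rewrite mem_filter ql andbT -xq; move: xD; rewrite (end_stepsE inv) // => /andP[].
Qed.

(** The allowed excess of the law of a label over its weight, up to [(1 - ph)^-1]: the constants of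
    all charges stepping out of the site, and [delta^-1] to offset them where the label is weighed
    with [r]. *)
Definition site_factor (q : G * option nat) :=
  (\prod_(s < sig.+1) (if q.1 \in D s then step_bs s q.1 else 1)) *
  (if q.2 == None then delta^-1 else 1).

Lemma site_bound q : q \in lab ->
  0 <= label_prob r p (v q.1) <= label_weight ph rh q.2 (v q.1) *
    (if v q.1 then (1 - ph)^-1 * site_factor q else p / ph).
Proof.
move=> ql; have [ph0 ph1] := andP ph01; have [p_ge0 p_le1] := andP p01.
have q0 : 0 < 1 - ph by rewrite subr_gt0.
have := @labelled_type q; rewrite mem_filter ql andbT /=.
rewrite /site_factor /step_bs /step_value.
case vq: (mu q.1 w) => [k|] /= tq; last by rewrite p_ge0 mulrCA divff ?gt_eqF // mulr1 lexx.
have rk := r_ge0 k.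
rewrite mulr_ge0 ?subr_ge0 //= mulrACA mulfV ?gt_eqF // mul1r.
apply: (@le_trans _ _ (r k)); first by rewrite ler_piMl // gerBl.
have [[s [-> ss qD]]|[-> _]] := tq isT.
  by rewrite mulr1; apply: (@beta_bound k s (fun s' => q.1 \in D s')).
rewrite rh_circE ler_peMr // -ler_pdivrMr ?invr_gt0; last by case/andP: delta01.
by rewrite div1r invrK; apply: (@delta_bound k (fun s' => q.1 \in D s')).
Qed.

Lemma prod_step_bs_ge0 : 0 <= \prod_(s < sig.+1) \prod_(x <- D s) step_bs s x.
Proof.
apply: prodr_ge0 => s _; apply: prodr_ge0 => x _.
by rewrite /step_bs /step_value; case: (mu x w).
Qed.

Lemma prod_site_le :
  \prod_(q <- lab) (if v q.1 then (1 - ph)^-1 * site_factor q else p / ph) <=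
  (1 - ph) ^- (sig.+1 * size (D sig) + size X) * delta ^- size X *
  (\prod_(s < sig.+1) \prod_(x <- D s) step_bs s x) * (p / ph) ^+ (size X).+1.
Proof.
have [ph0 ph1] := andP ph01; have [p_ge0 _] := andP p01; have [d0 d1] := andP delta01.
have q0 : 0 < 1 - ph by rewrite subr_gt0.
have q1 : 1 - ph <= 1 by rewrite gerBl ltW.
rewrite (bigID (fun q => isSome (v q.1))) /=.
rewrite (eq_bigr (fun q => (1 - ph)^-1 * site_factor q)) => [|q ->] //.
rewrite [X in _ * X](eq_bigr (fun=> p / ph)) => [|q /negbTE ->] //.
rewrite -big_filter prod_seqM big_const_seq -size_filter iter_mulr_1.
rewrite -[X in (p / ph) ^+ X](size_map fst) -/(end_sinks v lab) size_end_sinks.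
apply: ler_wpM2r; first by rewrite exprn_ge0 // divr_ge0 // ltW.
rewrite [X in _ * X]big_split /= prod_bs.
rewrite -[leRHS]mulrA [delta ^- _ * _]mulrC.
have bs0 := prod_step_bs_ge0.
(* The numbers of labelled sites are known only from above; this suffices since [(1 - ph)^-1] and
   [delta^-1] are at least 1. *)
apply: ler_pM.
- by rewrite exprn_ge0 // invr_ge0 ltW.
- rewrite mulr_ge0 //; apply: prodr_ge0 => q _; case: ifP => // _.
  by rewrite invr_ge0 ltW.
- by rewrite -exprVn ler_weXn2l ?size_labelled // invf_ge1.
rewrite ler_wpM2l // -big_mkcond big_const_seq -size_filter iter_mulr_1 -exprVn.
by rewrite ler_weXn2l ?size_labelled_circ // invf_ge1.
Qed.

Lemma completed_run_good : good_leaf r p (p / (ph * (1 - ph))) (label_of mu w lab)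
  (run_weight sig nx src st mu w ph rh abul acirc gb gc sb sc lab V [::]).
Proof.
have [ph0 ph1] := andP ph01; have [p_ge0 p_le1] := andP p01; have [d0 d1] := andP delta01.
have q0 : 0 < 1 - ph by rewrite subr_gt0.
rewrite /good_leaf; have -> : unzip1 (label_of mu w lab) = unzip1 lab.
  by rewrite /label_of /unzip1 -map_comp.
rewrite (run_lab inv) /= big_map /=.
(* There is one more defect than forks, so some defect was revealed; for [p = 0] its label has
   probability 0. *)
have [p0|p0] := eqVneq p 0.
  have : (0 < size N)%N by rewrite size_end_sinks.
  rewrite size_map -has_predT has_filter -size_eq0 => N0.
  rewrite (_ : \prod_(q <- lab) _ = 0) ?p0 ?mul0r //.
  apply/eqP; rewrite prodf_seq_eq0; move: N0; rewrite size_filter => N0.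
  apply/hasP.
  have : has (fun q => ~~ v q.1) lab by rewrite has_filter; case: [seq _ <- _ | _] N0.
  by case/hasP=> q ql vq; exists q => //=; move: vq; case: (mu q.1 w); rewrite /= ?p0.
have le1 : \prod_(q <- lab) label_prob r p (v q.1) <=
    (\prod_(q <- lab) label_weight ph rh q.2 (v q.1)) *
    \prod_(q <- lab) (if v q.1 then (1 - ph)^-1 * site_factor q else p / ph).
  rewrite -big_split; apply: proj2 (andP _).
  by apply: ler_prod_seq => q; apply: site_bound.
apply: le_trans le1 _.
have WL0 : 0 <= \prod_(q <- lab) label_weight ph rh q.2 (v q.1).
  rewrite big_seq; apply: prodr_ge0 => q ql.
  have := @labelled_type q; rewrite mem_filter ql andbT /=.
  case: (mu q.1 w) => [k|] /= tq; last exact: ltW.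
  rewrite mulr_ge0 ?(ltW q0) // rh_ge0 //.
  by have [[s [-> ss _]]|[->]] := tq isT.
rewrite /run_weight cats0 (prod_move_weight C inv) (prod_push_weight C inv).
apply: le_trans (ler_wpM2l WL0 prod_site_le) _.
have c0 : 0 <= p / (ph * (1 - ph)) by rewrite divr_ge0 // mulr_ge0 // ltW.
set W := \prod_(q <- lab) _ in WL0 *.
set B1 := \prod_(s < sig) \prod_(x <- D s) _; set B2 := \prod_(x <- D sig) _.
set C1 := \prod_(s < sig) \prod_(e <- X) _; set C2 := \prod_(e <- X) _.
rewrite -[W * (B1 * C1) * (B2 * C2)]mulrA [B1 * C1 * (B2 * C2)]mulrACA.
rewrite [leRHS]mulrCA ler_wpM2l //.
have bs0 := prod_step_bs_ge0.
have ef0 : 0 <= \prod_(s < sig.+1) \prod_(x <- D s) bul_factor s x.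
  by apply: prodr_ge0 => s _; apply: prodr_ge0 => x _; apply: expR_ge0.
have cf0 : 0 <= \prod_(s < sig.+1) \prod_(e <- X) circ_factor s e.
  by apply: prodr_ge0 => s _; apply: prodr_ge0 => x _; apply: expR_ge0.
have := ler_pM _ _ bul_part (circ_part p0); rewrite -/B1 -/B2 -/C1 -/C2 => le2.
apply: le_trans (ler_wpM2l c0 (le2 _ _)); last 2 first.
- rewrite mulr_ge0 ?invr_ge0 ?exprn_ge0 ?(ltW q0) //.
  by under eq_bigr do rewrite big_split /=; rewrite big_split mulr_ge0.
- by rewrite mulr_ge0 // exprn_ge0 // divr_ge0 // ltW.
have -> : \prod_(s < sig.+1) \prod_(x <- D s) (bul_factor s x * step_bs s x) =
    (\prod_(s < sig.+1) \prod_(x <- D s) bul_factor s x) *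
    \prod_(s < sig.+1) \prod_(x <- D s) step_bs s x.
  by rewrite -big_split; apply: eq_bigr => s _; rewrite big_split.
have := prod_polar; set E1 := \prod_(s < sig.+1) _; set E2 := \prod_(s < sig.+1) _ => E12.
set Bs := \prod_(s < sig.+1) _ in bs0 *.
set a := (sig.+1 * _)%N; set k := size X.
have -> : p / (ph * (1 - ph)) * ((1 - ph) ^- a * (E1 * Bs) *
     ((p / (ph * (1 - ph)) / delta) ^+ k * E2)) =
   ((1 - ph) ^- a * delta ^- k * Bs * (p / ph) ^+ k.+1) * (1 - ph) ^- k.+1 * (E1 * E2).
  rewrite [in RHS]exprSr [in (1 - ph) ^- k.+1]exprSr !exprMn !exprVn !exprMn !invfM.
  by ring.
(* [c0] pays the factor [p / ph] of the defect in excess of the forks; its [(1 - ph)^-1] is to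
   spare, which is the final comparison of the exponents [k] and [k.+1]. *)
rewrite E12 mulr1 exprD invfM -!mulrA ler_wpM2l ?invr_ge0 ?exprn_ge0 ?(ltW q0) //.
rewrite [leLHS]mulrC -!mulrA ler_wpM2l ?invr_ge0 ?exprn_ge0 ?(ltW d0) //.
rewrite ler_wpM2l // ler_wpM2l ?exprn_ge0 ?divr_ge0 ?(ltW ph0) //.
by rewrite -!exprVn ler_weXn2l // invf_ge1 // gerBl ltW.
Qed.

End GoodEnd.

Lemma jump_mul (G : cgroup) (y j : G) : jump y (cg_mul y j) = j.
Proof. by rewrite /jump cg_mulA cg_mulV cg_mul1. Qed.

(** Cutting [A] down to level one does not change what [phi] sees, so minimality leaves nothing
    outside that level. *)
Lemma minimal_one_set_level (G : cgroup) (h : G -> int) (phi : conf G -> bool) (A : set G) :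
  local_on_level_one h phi -> minimal_one_set phi A -> A `<=` [set j | h j = 1].
Proof.
move=> [D [_ D1 Dphi]] [_ phiA minA].
have <- : A `&` [set j | h j = 1] = A.
  apply: minA => //; rewrite -phiA; apply: Dphi => j /D1 /= hj.
  by apply/asboolP/asboolP => [[]|].
by move=> j [].
Qed.

(** * Zeros of the maximal trajectory *)

Section ZeroSites.
Context (G : cgroup) (m sig : nat) (h : G -> int) (phi : 'I_m -> conf G -> bool)
  (A : nat -> 'I_m -> set G) (v : G -> option 'I_m).
Hypothesis sig_gt0 : (0 < sig)%N.
Hypothesis h_morph : height_fun h.
Hypothesis phi_ok : forall k, [/\ local_on_level_one h (phi k), monotone_map (phi k)
               & nonconstant_map (phi k)].
Hypothesis A_min : forall s k, (s <= sig)%N -> minimal_one_set (phi k) (A s k).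

Definition update_ones (u : G -> option 'I_m) (N : nat) : conf G :=
  iter N (Phi phi u) (fun=> true).

Notation ones := (update_ones v).

Lemma update_onesS N y : ones N.+1 y ==> ones N y.
Proof.
elim: N y => [|N IH] y; first by rewrite implybT.
rewrite -[ones N.+2 y]/(Phi phi v (ones N.+1) y) -[ones N.+1 y]/(Phi phi v (ones N) y) /Phi.
case: (v y) => // k; have [_ mon _] := phi_ok k; apply: mon => j; exact: IH.
Qed.

Lemma update_ones_le M N y : (M <= N)%N -> ones N y -> ones M y.
Proof.
move=> /subnK <-; elim: (N - M)%N => // k IH.
by rewrite addSn => /(implyP (update_onesS _ _))/IH.
Qed.

(** By monotonicity every trajectory stays below all iterates. Their decreasing limit is itself a
    trajectory, because each [phi k] reads finitely many sites and the limit is attained there after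
    finitely many iterations. *)
Lemma maximal_trajectory_ones x y : is_maximal_trajectory phi v x ->
  x y = `[< forall N, ones N y >].
Proof.
move=> [tx mx]; apply/idP/asboolP.
  move=> xy N; elim: N y xy => // N IH y; rewrite tx /update_ones iterS /Phi.
  case: (v y) => // k; have [_ mon _] := phi_ok k; apply/implyP; apply: mon => j.
  by apply/implyP; apply: IH.
move=> all1; pose z : conf G := fun i => `[< forall N, ones N i >].
suff tz : is_trajectory phi v z by apply: (implyP (mx z tz y)); apply/asboolP.
move=> i; rewrite /Phi; case vi: (v i) => [k|]; last first.
  by apply/asboolP => /(_ 1%N); rewrite /update_ones /= /Phi vi.
have [[D [finD _ depD]] mon _] := phi_ok k.
have [l Dl] := (finite_seqP _).1 finD.
have [N0 HN0] : exists N0, forall N j, (N0 <= N)%N -> j \in l ->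
    ones N (cg_mul i j) = z (cg_mul i j).
  elim: {Dl} l => [|j l [N0 IH]]; first by exists 0%N.
  have [N1 HN1] : exists N1, forall N, (N1 <= N)%N -> ones N (cg_mul i j) = z (cg_mul i j).
    rewrite /z; case: asboolP => [a|/existsNP[N1 n1]]; first by exists 0%N => N _; apply: a.
    by exists N1 => N le_N; apply/negP => /(update_ones_le le_N).
  exists (maxn N0 N1) => N j'; rewrite geq_max => /andP[le0 le1].
  by rewrite inE => /predU1P[->|/IH]; [apply: HN1 | apply].
have phiz N : (N0 <= N)%N -> phi k (fun j => z (cg_mul i j)) = ones N.+1 i.
  move=> le_N; rewrite /update_ones iterS /Phi vi; apply: depD => j.
  by rewrite Dl /= => jl; rewrite -(HN0 N).
apply/asboolP/idP => [a|zi N]; first by rewrite (phiz N0).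
have [le_N|lt_N] := leqP N N0.+1; first by apply: update_ones_le le_N _; rewrite -phiz.
by case: N lt_N => // N; rewrite ltnS => /ltnW le_N; rewrite -phiz.
Qed.

Definition zero_site y := `[< exists N, ~~ ones N y >].

(** The first iterate vanishing at [y]; it serves as the depth [dp]. The default 0 is never the
    depth of a zero, as iterate 0 is constantly 1. *)
Definition zero_depth y : nat :=
  if pselect (exists N, ~~ ones N y) is left e then ex_minn e else 0.

Lemma zero_depthP y : zero_site y -> exists N, [/\ zero_depth y = N.+1, ~~ ones N.+1 y &
  forall M, ~~ ones M y -> (N < M)%N].
Proof.
move=> /asboolP e; rewrite /zero_depth; case: pselect => // e'.
case: ex_minnP => -[//|N] nN minN; exists N; split=> // M; exact: minN.
Qed.

Definition zero_next s y : G :=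
  if v y is Some k then
    if pselect (exists j, A s k j /\ ~~ ones (zero_depth y).-1 (cg_mul y j)) is left e
    then cg_mul y (projT1 (cid e)) else y
  else y.

(** Were the preceding iterate 1 on all of the translated [A s k], monotonicity and the value of
    [phi k] on [A s k] would force a 1 at [y]. So some displacement leads to a site that vanished
    strictly earlier. *)
Lemma zero_nextP s y k : (s <= sig)%N -> zero_site y -> v y = Some k ->
  exists j, [/\ A s k j, zero_next s y = cg_mul y j, zero_site (cg_mul y j) &
    (zero_depth (cg_mul y j) < zero_depth y)%N].
Proof.
move=> ss zy vy; have [N [dN nN _]] := zero_depthP zy.
rewrite /zero_next vy dN /=; case: pselect => [e|ne].
  case: (cid e) => /= j [Aj nj]; exists j; split=> //; first by apply/asboolP; exists N.
  have zj : zero_site (cg_mul y j) by apply/asboolP; exists N.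
  by have [N' [-> _ minN']] := zero_depthP zj; rewrite ltnS; apply: minN'.
have [_ mon _] := phi_ok k; have [_ phiA _] := A_min k ss.
case/negP: nN; rewrite /update_ones iterS /Phi vy.
apply: (implyP (mon (Defs.indic (A s k)) _ _)) phiA => j.
apply/implyP => /asboolP Aj; apply: contrapT => nj; apply: ne; exists j; split=> //.
exact/negP.
Qed.

Lemma zero_contour o : zero_site o -> exists nx n Q src st,
  [/\ is_contour v sig o h nx n Q src st,
      forall s y k, (s <= sig)%N -> y \in path_sites nx n Q st s -> v y = Some k ->
        A s k (jump y (nx s y)) &
      forall s e k, (s <= sig)%N -> (0 < e < n)%N -> v (src e) = Some k ->
        (\bigcup_(s in `I_sig.+1) A s k) (jump (src e) (st s e))].
Proof.
move=> zo; pose sink y := ~~ v y.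
have nx_zero s y : (s < sig.+1)%N -> zero_site y -> ~~ sink y ->
    zero_site (zero_next s y) /\ (zero_depth (zero_next s y) < zero_depth y)%N.
  rewrite ltnS /sink negbK => ss zy; case vy: (v y) => [k|] // _.
  by have [j [_ -> zj dj]] := zero_nextP ss zy vy.
have nx_sink s y : sink y -> zero_next s y = y.
  by rewrite /sink /zero_next; case: (v y).
have [K [E [[uK [srcE tree]] rootK]]] := exists_fork_tree (ltn0Sn sig) nx_zero nx_sink zo.
pose endp := endpoint zero_next zero_depth.
have /choice[ch chP] s : exists l : seq G, (s <= sig)%N ->
    all2 (is_child sig.+1 zero_next) E l /\ perm_eq (map (endp s) (o :: l)) K.
  case: (leqP s sig) => [ss|_]; last by exists [::].
  (* The free place of the fork tree goes to the path from [o]: together with the paths from the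
     forks it exhausts [K]. *)
  by have [l lE lK] := tree s _ ss (rootK s ss); exists l.
pose n := (size E).+1; pose src e := nth o (o :: E) e; pose st s e := nth o (o :: ch s) e.
(* Depths bound path lengths, so the largest depth of a start brings all paths to rest. *)
pose Q := \max_(s < sig.+1) \max_(e < n) zero_depth (st s e).
have szch s : (s <= sig)%N -> size (ch s) = size E.
  by move=> /chP[]; rewrite all2E => /andP[/eqP ->].
have src_ok e : (0 < e < n)%N -> zero_site (src e) /\ v (src e).
  case: e => // e; rewrite ltnS => /andP[_ en]; rewrite /src /=.
  by have /allP/(_ _ (mem_nth o en)) := srcE; rewrite /source /sink negbK => /andP[].
have child s e : (s <= sig)%N -> (0 < e < n)%N ->
    exists i k j, [/\ (i <= sig)%N, v (src e) = Some k, A i k j & st s e = cg_mul (src e) j].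
  move=> ss e0n; have [zs vs] := src_ok e e0n.
  case: e e0n zs vs => // e; rewrite ltnS => /andP[_ en]; rewrite /src /st /= => zs vs.
  have [+ _] := chP s ss; rewrite all2E => /andP[_ /(all_nthP (o, o))/(_ e)].
  rewrite size_zip szch // minnn nth_zip ?szch // => /(_ en)/hasP[i].
  rewrite mem_iota /= => si /eqP <-; case vk: (v (nth o E e)) vs => [k|] // _.
  by have [j [Aj -> _ _]] := zero_nextP si zs vk; exists i, k, j.
have st_zero s e : (s <= sig)%N -> (e < n)%N -> zero_site (st s e).
  move=> ss en; case: (posnP e) => [->//|e0].
  have e0n : (0 < e < n)%N by rewrite e0.
  have [zs _] := src_ok e e0n.
  case: e en e0 e0n zs => // e; rewrite ltnS => en _ _; rewrite /src /st /= => zs.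
  have [+ _] := chP s ss; rewrite all2E => /andP[_ /(all_nthP (o, o))/(_ e)].
  rewrite size_zip szch // minnn nth_zip ?szch // => /(_ en)/hasP[i].
  rewrite mem_iota /= => si /eqP <-.
  have /allP/(_ _ (mem_nth o en))/andP[_ ns] := srcE.
  by have [] := nx_zero i _ si zs ns.
have iterQ s e : (s <= sig)%N -> (e < n)%N ->
    iter Q (zero_next s) (st s e) = endp s (st s e) /\ sink (endp s (st s e)).
  move=> ss en; apply: (iter_endpoint nx_zero nx_sink) => //; first exact: st_zero.
  apply: leq_trans (leq_bigmax_cond (Ordinal (ss : (s < sig.+1)%N)) isT) => /=.
  exact: (leq_bigmax_cond (Ordinal en) isT).
have endnth s e : (s <= sig)%N -> (e < n)%N ->
    endp s (st s e) = nth o (map (endp s) (o :: ch s)) e.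
  by move=> ss en; rewrite (nth_map o) //= szch.
have path_zero s y : (s <= sig)%N -> y \in path_sites zero_next n Q st s -> zero_site y.
  move=> ss /allpairsP[[e q] [en _ ->]].
  have {}en : (e < n)%N by move: en; rewrite mem_iota.
  by have [] := endpoint_iter nx_zero nx_sink q (ss : (s < sig.+1)%N) (st_zero s e ss en).
have lev k i : (i <= sig)%N -> A i k `<=` [set j | h j = 1].
  move=> si; have [loc _ _] := phi_ok k.
  exact: minimal_one_set_level loc (A_min k si).
exists zero_next, n, Q, src, st; split.
- split=> //.
  + by move=> s y _; apply: nx_sink.
  + by move=> s e ss en; have [-> sk] := iterQ s e ss en.
  + move=> s e e' ss en en'; have [-> _] := iterQ s e ss en; have [-> _] := iterQ s e' ss en'.
    rewrite !endnth // => /eqP; rewrite nth_uniq ?size_map /= ?szch // => [/eqP //|].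
    by have [_ /perm_uniq U] := chP s ss; move: uK; rewrite -U.
  + move=> s e ss en; have [-> _] := iterQ s e ss en; rewrite endnth //.
    have [_ pe] := chP s ss; have [_ pe'] := chP sig (leqnn _).
    have : nth o (map (endp s) (o :: ch s)) e \in map (endp sig) (o :: ch sig).
      by rewrite (perm_mem pe') -(perm_mem pe) mem_nth // size_map /= szch.
    case/(nthP o) => e'; rewrite size_map /= szch // => e'n <-; exists e' => //.
    by have [-> _] := iterQ sig e' (leqnn _) e'n; rewrite endnth.
  + move=> s y ss py; case vy: (v y) => [k|] // _.
    have [j [Aj -> _ _]] := zero_nextP ss (path_zero s y ss py) vy.
    by rewrite h_morph (lev _ _ ss _ Aj).
  + move=> s e ss e0n; have [i [k [j [si _ Aj ->]]]] := child s e ss e0n.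
    by rewrite h_morph (lev _ _ si _ Aj).
  + by move=> e /src_ok[].
- move=> s y k ss py vy.
  by have [j [Aj -> _ _]] := zero_nextP ss (path_zero s y ss py) vy; rewrite jump_mul.
- move=> s e k ss e0n vk; have [i [k' [j [si vk' Aj ->]]]] := child s e ss e0n.
  move: Aj; rewrite vk in vk'; case: vk' => <- Aj; rewrite jump_mul.
  by exists i.
Qed.

End ZeroSites.

(** * Measurability and extended real constants *)

Lemma measurable_local (G : cgroup) (d : measure_display)
    (Omega : measurableType d) (F : conf G -> bool) (l : seq G) (x : Omega -> conf G) :
  depends_only_on F [set` l] -> (forall j, measurable [set w | x w j]) ->
  measurable [set w | F (x w)].
Proof.
elim: l F => [|j l IH] F depF mx.
  have [F1|F0] := boolP (F (fun=> true)).
    rewrite (_ : [set _ | _] = setT) //; apply/seteqP; split => // w _ /=.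
    by rewrite (depF _ (fun=> true)).
  rewrite (_ : [set _ | _] = set0) //; apply/seteqP; split => // w /=.
  by rewrite (depF _ (fun=> true)) // (negbTE F0).
(* Fixing the value at [j] leaves functions of the remaining coordinates. *)
pose Fb b y := F (fun i => if i == j then b else y i).
have mFb b : measurable [set w | Fb b (x w)].
  apply: IH => // y z yz; apply: depF => i /=; rewrite inE.
  by case: eqP => //= _; apply: yz.
have FE w : F (x w) = Fb (x w j) (x w).
  by apply: depF => i _ /=; case: eqP => // ->.
have -> : [set w | F (x w)] = ([set w | x w j] `&` [set w | Fb true (x w)]) `|`
    (~` [set w | x w j] `&` [set w | Fb false (x w)]).
  apply/seteqP; split => w /=; rewrite FE.
    by case: (x w j) => Fw; [left | right].
  by move=> [[-> //]|[/negP/negbTE -> //]].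
by apply: measurableU; apply: measurableI => //; apply: measurableC.
Qed.

Lemma measurable_update_ones (G : cgroup) (m : nat) (h : G -> int) (d : measure_display)
    (Omega : measurableType d) (phi : 'I_m -> conf G -> bool)
    (mu : G -> Omega -> option 'I_m) :
  (forall k, local_on_level_one h (phi k)) ->
  (forall i l, measurable [set w | mu i w = l]) ->
  forall N i, measurable [set w | update_ones phi (mu ^~ w) N i].
Proof.
move=> loc mmu; elim=> [|N IH] i.
  by rewrite (_ : [set _ | _] = setT) //; apply/seteqP; split.
have -> : [set w | update_ones phi (mu ^~ w) N.+1 i] =
    \bigcup_(k in [set: 'I_m]) ([set w | mu i w = Some k] `&`
      [set w | phi k (fun j => update_ones phi (mu ^~ w) N (cg_mul i j))]).
  have E w : update_ones phi (mu ^~ w) N.+1 i =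
      Phi phi (mu ^~ w) (update_ones phi (mu ^~ w) N) i by [].
  apply/seteqP; split => [w|w [k _ [e pk]]]; rewrite /mkset E /Phi.
    by case e: (mu i w) => [k|] // ph; exists k.
  by rewrite (e : mu i w = Some k).
apply: measurable_bigcup_countType => k; apply: measurableI => //.
have [D [finD _ depD]] := loc k; have [l Dl] := (finite_seqP _).1 finD.
apply: (@measurable_local _ _ _ (phi k) l
  (fun w j => update_ones phi (mu ^~ w) N (cg_mul i j))); first by rewrite -Dl.
by move=> j; apply: IH.
Qed.

Lemma ereal_inf_ratio (R : realType) (S : set (\bar R)) (u t x : R) :
  (forall c, S c -> (0 <= c)%E /\ (u%:E <= c * t%:E)%E) -> 0 <= t ->
  ereal_inf S = x%:E -> u <= x * t.
Proof.
move=> Sut t0 infx; have [t00|tn0] := eqVneq t 0.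
  (* Here the claim is [u <= 0], which any element of [S] gives; [S] is nonempty because its infimum
     is finite. *)
  have [c Sc] : exists c, S c.
    apply: contrapT => nS; have S0 : S = set0.
      by apply/seteqP; split=> c // Sc; case: nS; exists c.
    by move: infx; rewrite S0 ereal_inf0.
  by have [_] := Sut c Sc; rewrite t00 mule0 mulr0 lee_fin.
have tp : 0 < t by rewrite lt_neqAle eq_sym tn0.
rewrite -ler_pdivrMr // -lee_fin -infx; apply: le_ereal_inf_tmp => c /Sut[c0].
case: c c0 => [c _|_ _|//]; last by rewrite leey.
by rewrite -EFinM !lee_fin ler_pdivrMr.
Qed.

Lemma alpha_const_ge0 (R : realType) (G : cgroup) (u : G -> R) (D : set G) (a : G -> R) :
  (0 <= alpha_const u D a)%E.
Proof. by apply: le_ereal_inf_tmp => c []. Qed.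

Lemma alpha_const_le (R : realType) (G : cgroup) (u : G -> R) (D : set G) (a : G -> R) j :
  alpha_const u D a != +oo%E -> 0 <= a j -> D j ->
  u j <= fine (alpha_const u D a) * a j.
Proof.
move=> fin a0 Dj; apply: ereal_inf_ratio a0 _; last first.
  by rewrite fineK // ge0_fin_numE ?alpha_const_ge0 // lt_neqAle fin leey.
by move=> c [c0 /(_ j Dj)].
Qed.

Lemma subprob_on_seq (R : realType) (G : cgroup) (A : set G) (a : G -> R) :
  finite_set A -> subprob_on A a ->
  (forall j, 0 <= a j) /\ forall J, uniq J -> \sum_(j <- J) a j <= 1.
Proof.
move=> finA [a0 aA a1]; split=> // J uJ.
have [l0 A0] := (finite_seqP _).1 finA; pose l := undup l0.
have Al : A = [set` l] by rewrite A0; apply/seteqP; split => x /=; rewrite mem_undup.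
rewrite Al -fsbig_seq ?undup_uniq // in a1; apply: le_trans a1.
rewrite (bigID (mem l)) /= [X in _ + X]big1 ?addr0 => [|j jl]; last first.
  by apply: aA; rewrite Al; apply/negP.
rewrite [leRHS](bigID (mem J)) /= -[leLHS]addr0 lerD ?sumr_ge0 // -[leLHS]big_filter -[leRHS]big_filter.
rewrite le_eqVlt (perm_big [seq j <- l | j \in J]) ?eqxx //.
by apply: uniq_perm; rewrite ?filter_uniq ?undup_uniq // => j; rewrite !mem_filter andbC.
Qed.

Lemma sum_le_esum (R : realType) (T : choiceType) (f : T -> R) (J : seq T) :
  uniq J -> (((\sum_(j <- J) f j)%:E) <= \esum_(j in [set: T]) (f j)%:E)%E.
Proof.
move=> uJ; apply: esum_ge; exists [set` J]; first by split.
by rewrite -fsbig_seq // -sumEFin.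
Qed.

(** A finite value does not make [c] finite, as [+oo] times a vanishing product is 0. Hence the
    bound is stated for real minorants [x] of [c], which will be finite partial sums. *)
Lemma prod_inf_ge (R : realType) (c : \bar R) (n : nat) (g : nat -> \bar R) (x : R) :
  (prod_inf c n g < +oo)%E -> (forall s, (s < n)%N -> (0 <= g s)%E) ->
  0 <= x -> (x%:E <= c)%E ->
  (forall s, (s < n)%N -> g s \is a fin_num) /\
  ((x * \prod_(s < n) fine (g s))%:E <= prod_inf c n g)%E.
Proof.
rewrite /prod_inf; case: ifP => // /forallP gfin _ g0 x0 xc.
have gf s : (s < n)%N -> g s \is a fin_num.
  by move=> sn; rewrite ge0_fin_numE ?g0 // lt_neqAle (gfin (Ordinal sn)) leey.
split=> //; rewrite EFinM -prodEFin.
rewrite (eq_bigr (fun s : 'I_n => g s)) => [|s _]; last by rewrite fineK ?gf.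
by rewrite lee_wpmul2r // prode_ge0 // => s _; apply: g0.
Qed.

(** * Probability of a zero and choice of the constants *)

Section ZeroProbability.
Context (R : realType) (G : cgroup) (h : G -> int) (m sig : nat)
  (phi : 'I_m -> conf G -> bool) (r : 'I_m -> R) (p ph : R)
  (d : measure_display) (Omega : measurableType d) (P : probability Omega R)
  (mu : G -> Omega -> option 'I_m).
Hypothesis mu_law : forall i, site_law P r p (mu i).
Hypothesis mu_indep : mutually_independent P mu.
Variables (rh : option nat -> 'I_m -> R) (abul acirc : nat -> 'I_m -> G -> R)
  (gb gc : R) (sb sc : G -> R) (Bb Bc : R)
  (lam : R) (L : nat -> G -> R) (A : nat -> 'I_m -> set G)
  (bs : nat -> 'I_m -> R) (gB gC : nat -> R) (delta : R).
Let Delta k := \bigcup_(s in `I_sig.+1) A s k.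

Hypothesis sig_gt0 : (0 < sig)%N.
Hypothesis h_morph : height_fun h.
Hypothesis phi_ok : forall k, [/\ local_on_level_one h (phi k), monotone_map (phi k)
  & nonconstant_map (phi k)].
Hypothesis A_min : forall s k, (s <= sig)%N -> minimal_one_set (phi k) (A s k).
Hypothesis p01 : 0 <= p <= 1.
Hypothesis ph01 : 0 < ph < 1.
Hypothesis rh_prob : forall t, (odflt 0%N t <= sig)%N ->
  (forall k, 0 <= rh t k) /\ \sum_(k < m) rh t k = 1.
Hypothesis rh_circE : rh None = r.
Hypothesis abul_sub : forall s k, (s <= sig)%N -> (forall j, 0 <= abul s k j) /\
  forall J, uniq J -> \sum_(j <- J) abul s k j <= 1.
Hypothesis acirc_sub : forall s k, (s <= sig)%N -> (forall j, 0 <= acirc s k j) /\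
  forall J, uniq J -> \sum_(j <- J) acirc s k j <= 1.
Hypothesis gb_ge0 : forall j, 0 <= gb * sb j.
Hypothesis gc_ge0 : forall j, 0 <= gc * sc j.
Hypothesis back_bul : forall J, uniq J -> \sum_(j <- J) gb * sb j <= Bb.
Hypothesis back_circ : forall J, uniq J -> \sum_(j <- J) gc * sc j <= Bc.
Hypothesis BbBc : Bb + Bc <= 1.
Hypothesis bs_ge0 : forall s k, 0 <= bs s k.
Hypothesis gB_ge0 : forall s, (s <= sig)%N -> 0 <= gB s.
Hypothesis gC_ge0 : forall s, (s <= sig)%N -> 0 <= gC s.
Hypothesis sbE : forall k j, abul sig k j <= sb j.
Hypothesis scE : forall k j, acirc sig k j <= sc j.
Hypothesis bul_bound : forall s k j, (s <= sig)%N -> A s k j ->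
  expR (- lam * L s j) * bs s k <= gB s * abul s k j.
Hypothesis circ_bound : p != 0 -> forall s k j, (s <= sig)%N -> Delta k j ->
  expR (- lam * L s j) <= gC s * acirc s k j.
Hypothesis gbE : gb = (1 - ph) ^- sig.+1 * \prod_(s < sig.+1) gB s.
Hypothesis gcE : p != 0 -> gc = p / (ph * (1 - ph)) / delta * \prod_(s < sig.+1) gC s.
Hypothesis delta01 : 0 < delta <= 1.
Hypothesis delta_bound : forall k (S : pred nat),
  delta <= \prod_(s < sig.+1) (if S s then bs s k else 1).
Hypothesis beta_bound : forall k s0 (S : pred nat), (s0 <= sig)%N -> S s0 ->
  r k <= rh (Some s0) k * \prod_(s < sig.+1) (if S s then bs s k else 1).
Hypothesis L_morph : forall s i j, (s <= sig)%N -> L s (cg_mul i j) = L s i + L s j.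
Hypothesis L_polar : forall i, \sum_(s < sig.+1) L s i = 0.

Lemma prob_zero_site o :
  (P [set w | zero_site phi (mu ^~ w) o] <= (p / (ph * (1 - ph)))%:E)%E.
Proof.
have [ph0 ph1] := andP ph01; have [p_ge0 _] := andP p01.
set c0 := p / (ph * (1 - ph)).
have c0_ge0 : 0 <= c0 by rewrite divr_ge0 // mulr_ge0 ?subr_ge0 // ltW.
pose F N := explored mu r p sig o ph rh abul acirc gb gc sb sc c0 N [::]
  [seq Fwd s o | s <- iota 0 sig] 1.
have mF N : measurable (F N) by exact: (measurable_explored mu_law).
have mones N : measurable [set w | update_ones phi (mu ^~ w) N o].
  apply: (@measurable_update_ones _ _ h); first by move=> k; have [] := phi_ok k.
  by move=> i l; have [] := mu_law i.
apply: (@le_trans _ _ (P (\bigcup_N F N))); last first.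
  apply: prob_nondecreasing_le => // N; first exact: exploredS.
  have ph01' : 0 <= ph <= 1 by rewrite (ltW ph0) ltW.
  rewrite -[c0]mulr1; exact: (prob_explored mu_law mu_indep o c0_ge0 ph01' rh_prob
    abul_sub acirc_sub gb_ge0 gc_ge0 back_bul back_circ BbBc).
apply: le_measure; rewrite ?inE.
- rewrite (_ : [set w | _] = \bigcup_N ~` [set w | update_ones phi (mu ^~ w) N o]).
    by apply: bigcupT_measurable => N; apply: measurableC.
  apply/seteqP; split => w.
    by move=> /asboolP[N /negP n1]; exists N.
  by move=> [N _ /negP n1]; apply/asboolP; exists N.
- exact: bigcupT_measurable.
(* A zero at [o] has a contour, and the exploration along it completes, so [w] lies in some
   [F N]. *)
move=> w zo.
have [nx [n [Q [src [st [C jb jc]]]]]] := zero_contour sig_gt0 h_morph phi_ok A_min zo.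
have [|N EN] := @explored_run_inv R G m sig o h nx n Q src st d Omega mu w C r p ph rh
    abul acirc gb gc sb sc c0 _ [::] [::] _ (run_inv0 C).
  move=> lab V inv; apply: (completed_run_good C inv (delta := delta) (L := L) (lam := lam)
    (A := A) (Delta := Delta) (bs := bs) (gB := gB) (gC := gC)) => //.
  - by move=> k; have [] := @rh_prob None (leq0n sig); rewrite rh_circE.
  - by move=> t k /rh_prob[].
  - by move=> s k j /(abul_sub k)[].
  - by move=> s k j /(acirc_sub k)[].
exists N => //; move: EN; rewrite /F.
have -> : map (task_of sig src) [seq (s, inl o) | s <- iota 0 sig] =
    [seq Fwd s o | s <- iota 0 sig].
  rewrite -map_comp; apply/eq_in_map => s; rewrite mem_iota => /andP[_ ss] /=.
  by rewrite ltn_eqF.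
suff -> : run_weight sig nx src st mu w ph rh abul acirc gb gc sb sc [::] [::]
    [seq (s, inl o) | s <- iota 0 sig] = 1 by [].
rewrite /run_weight !big_nil !mul1r big_map big_seq big1 // => s.
by rewrite mem_iota => /andP[_ ss] /=; rewrite ltn_eqF.
Qed.

End ZeroProbability.

(* Indices: s ranges over {0,..,sigma-1} (paper: 1..sigma), k over 'I_m
   (paper: 1..m); b s' s k stands for beta^{s'}_{s,k}. *)
Theorem theorem5 (R : realType) (G : cgroup) (h : G -> int) (m : nat)
  (phi : 'I_m -> conf G -> bool) (r : 'I_m -> R)
  (sigma : nat) (L : nat -> G -> R) (lam : R)
  (A : nat -> 'I_m -> set G) (abul acirc : nat -> 'I_m -> G -> R)
  (rhat_circ : 'I_m -> R) (rhat : nat -> 'I_m -> R)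
  (b : nat -> nat -> 'I_m -> R) (ph : R) :
  height_fun h ->
  (forall k, [/\ local_on_level_one h (phi k), monotone_map (phi k)
               & nonconstant_map (phi k)]) ->
  prob_dist r ->
  (2 <= sigma)%N -> polar_function sigma L ->
  (forall s k, (s < sigma)%N -> minimal_one_set (phi k) (A s k)) ->
  let Delta k := \bigcup_(s in `I_sigma) A s k in
  (forall s k, (s < sigma)%N ->
     subprob_on (A s k) (abul s k) /\ subprob_on (Delta k) (acirc s k)) ->
  prob_dist rhat_circ -> (forall s, (s < sigma)%N -> prob_dist (rhat s)) ->
  let alpha_bul s k :=
    alpha_const (fun i => expR (- lam * L s i)) (A s k) (abul s k) in
  let alpha_circ s k :=
    alpha_const (fun i => expR (- lam * L s i)) (Delta k) (acirc s k) in
  let beta s k := beta_const (r k) (rhat s k) in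
  rhat_circ = r ->
  (forall s s' k, (s < sigma)%N -> (s' < sigma)%N -> 0 < b s' s k) ->
  (forall s k, (s < sigma)%N -> beta s k = (\prod_(s' < sigma) b s' s k)%:E) ->
  (forall s s' k, (s < sigma)%N -> (s' < sigma)%N -> s != s' -> b s' s k <= 1) ->
  let betasup s k := \big[Num.max/0]_(s' < sigma) b s s' k in
  let delta := \big[Num.min/1]_(k < m) \prod_(s < sigma) Num.min 1 (betasup s k) in
  let gamma_bul s := \big[maxe/0%E]_(k < m) ((betasup s k)%:E * alpha_bul s k)%E in
  let gamma_circ s := \big[maxe/0%E]_(k < m) alpha_circ s k in
  let B_bul :=
    \esum_(j in [set: G]) (\big[Num.max/0]_(k < m) abul sigma.-1 k j)%:E in
  let B_circ :=
    \esum_(j in [set: G]) (\big[Num.max/0]_(k < m) acirc sigma.-1 k j)%:E in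
  let C_bul := prod_inf B_bul sigma gamma_bul in
  let C_circ := prod_inf (delta^-1%:E * B_circ)%E sigma gamma_circ in
  0 < ph < 1 ->
  let p_circ := (1 - ((1 - ph) ^- sigma)%:E * C_bul)%E in
  (0 < p_circ)%E ->
  let eps := ((ph * (1 - ph))%:E * p_circ / C_circ)%E in
  forall p : R, 0 <= p -> (p%:E <= eps)%E ->
  forall (d : measure_display) (Omega : measurableType d)
    (P : probability Omega R) (mu : G -> Omega -> option 'I_m),
    (forall i, site_law P r p (mu i)) -> mutually_independent P mu ->
  forall Xbar : Omega -> conf G,
    (forall w, is_maximal_trajectory phi (fun i => mu i w) (Xbar w)) ->
  forall i : G,
    (1 - P [set w | Xbar w i = true] <= (p / (ph * (1 - ph)))%:E)%E.
Proof.
move=> h_morph phi_ok r_prob; case: sigma => [//|sig] sg2 [Lm Lp] Amin Delta sub _.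
move=> rhat_prob alpha_bul alpha_circ beta _ b0 betaE b1 betasup delta gamma_bul gamma_circ.
move=> B_bul B_circ C_bul C_circ ph01 p_circ pc0 eps p p_ge0 pe d Omega P mu law indep Xbar Xmax i.
have [ph0 ph1] := andP ph01; have q0 : 0 < 1 - ph by rewrite subr_gt0.
have p01 : 0 <= p <= 1.
  by rewrite p_ge0 -lee_fin; have [mX [<- _]] := law i; apply: probability_le1; apply: mX.
have b_le s s' k : (s' < sig.+1)%N -> b s s' k <= betasup s k.
  by move=> ss'; apply: (le_bigmax _ (fun s' : 'I_sig.+1 => b s s' k) (Ordinal ss')).
have bs_ge0 s k : 0 <= betasup s k by apply: bigmax_ge_id.
have bs_gt0 s k : (s < sig.+1)%N -> 0 < betasup s k.
  by move=> ss; apply: lt_le_trans (b_le s 0%N k _) => //; apply: b0.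
have Afin s k : (s < sig.+1)%N -> finite_set (A s k) by move=> /Amin -/(_ k)[].
have Dfin k : finite_set (Delta k).
  by apply: bigcup_finite => [|s ss]; [exact: finite_II | exact: Afin].
have asub s k : (s < sig.+1)%N -> (forall j, 0 <= abul s k j) /\
    forall J, uniq J -> \sum_(j <- J) abul s k j <= 1.
  by move=> ss; exact: (subprob_on_seq (Afin s k ss) (proj1 (sub s k ss))).
have csub s k : (s < sig.+1)%N -> (forall j, 0 <= acirc s k j) /\
    forall J, uniq J -> \sum_(j <- J) acirc s k j <= 1.
  by move=> ss; exact: (subprob_on_seq (Dfin k) (proj2 (sub s k ss))).
have gbul0 s : (0 <= gamma_bul s)%E by apply: bigmax_ge_id.
have gcirc0 s : (0 <= gamma_circ s)%E by apply: bigmax_ge_id.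
have delta01 : 0 < delta <= 1.
  rewrite /delta bigmin_le_id andbT; elim/big_ind: _ => // [x y x0 y0|k _].
    by rewrite lt_min x0.
  by apply: prodr_gt0 => s _; rewrite lt_min ltr01 bs_gt0.
have [d0 d1] := andP delta01.
pose sb j := \big[Num.max/0]_(k < m) abul sig k j.
pose sc j := \big[Num.max/0]_(k < m) acirc sig k j.
have sb0 j : 0 <= sb j by apply: bigmax_ge_id.
have sc0 j : 0 <= sc j by apply: bigmax_ge_id.
(* An infinite [C_bul] would make [p_circ] equal to [-oo]. *)
have Cbul_fin : (C_bul < +oo)%E.
  rewrite ltey; apply/negP => /eqP CE; move: pc0; rewrite /p_circ CE gt0_muley //.
  by rewrite lte_fin invr_gt0 exprn_gt0.
have sums0 (f : G -> R) J : (forall j, 0 <= f j) -> 0 <= \sum_(j <- J) f j.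
  by move=> f0; apply: sumr_ge0.
have uniq0 : uniq ([::] : seq G) by [].
have bul_le J : uniq J ->
    (((\sum_(j <- J) sb j) * \prod_(s < sig.+1) fine (gamma_bul s))%:E <= C_bul)%E.
  move=> uJ; have [] := prod_inf_ge Cbul_fin (fun s _ => gbul0 s) (sums0 sb J sb0)
    (sum_le_esum _ uJ).
  by [].
have bul_fin s : (s < sig.+1)%N -> gamma_bul s \is a fin_num.
  have [+ _] := prod_inf_ge Cbul_fin (fun s _ => gbul0 s) (sums0 sb [::] sb0) (sum_le_esum _ uniq0).
  exact.
have Cbul0 : (0 <= C_bul)%E by have := bul_le [::] uniq0; rewrite big_nil mul0r.
pose cb := fine C_bul.
have cbE : C_bul = cb%:E by rewrite fineK // ge0_fin_numE.
pose Bb := (1 - ph) ^- sig.+1 * cb.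
have pcE : p_circ = (1 - Bb)%:E by rewrite /p_circ cbE.
have Bb1 : Bb <= 1 by move: pc0; rewrite pcE lte_fin subr_gt0 => /ltW.
pose gB s := fine (gamma_bul s); pose gb := (1 - ph) ^- sig.+1 * \prod_(s < sig.+1) gB s.
have gB0 s : 0 <= gB s by apply: fine_ge0.
have qn0 : 0 <= (1 - ph) ^- sig.+1 by rewrite invr_ge0 exprn_ge0 ?ltW.
have gb0 : 0 <= gb by rewrite mulr_ge0 // prodr_ge0.
have back_bul J : uniq J -> \sum_(j <- J) gb * sb j <= Bb.
  move=> uJ; rewrite -mulr_sumr /gb /Bb -mulrA ler_wpM2l // mulrC -lee_fin -cbE.
  exact: bul_le.
pose rh t := if t is Some s then rhat s else r.
have bul_bound s k j : (s <= sig)%N -> A s k j ->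
    expR (- lam * L s j) * betasup s k <= gB s * abul s k j.
  move=> ss Aj; have [a0 _] := asub s k ss.
  have le_g : ((betasup s k)%:E * alpha_bul s k <= gamma_bul s)%E.
    exact: (le_bigmax _ (fun k => (betasup s k)%:E * alpha_bul s k)%E k).
  have af : alpha_bul s k != +oo%E.
    apply/negP => /eqP aE; move: le_g; rewrite aE gt0_muley ?lte_fin ?bs_gt0 //.
    by rewrite leye_eq => /eqP gE; move: (bul_fin s ss); rewrite gE.
  have := alpha_const_le af (a0 j) Aj => le_a.
  apply: le_trans (ler_wpM2r (bs_ge0 s k) le_a) _.
  rewrite mulrAC ler_wpM2r // mulrC -lee_fin EFinM !fineK ?bul_fin //.
  by rewrite ge0_fin_numE ?alpha_const_ge0 // ltey.
(* If [C_circ] is infinite then [eps = 0], so a positive [p] makes it finite. For [p = 0] all fork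
   constants are set to 0. *)
have [gC [gc [Bc [[gC0 gc0] back_circ BbBc circ_bound gcE]]]] : exists (gC : nat -> R) (gc Bc : R),
    [/\ (forall s, 0 <= gC s) /\ 0 <= gc,
        forall J, uniq J -> \sum_(j <- J) gc * sc j <= Bc, Bb + Bc <= 1,
        p != 0 -> forall s k j, (s <= sig)%N -> Delta k j ->
          expR (- lam * L s j) <= gC s * acirc s k j &
        p != 0 -> gc = p / (ph * (1 - ph)) / delta * \prod_(s < sig.+1) gC s].
  have [pE|pn0] := eqVneq p 0.
    exists (fun=> 0), 0, 0; split=> //; last by rewrite addr0.
    by move=> J _; rewrite big1 // => j _; rewrite mul0r.
  have p_gt0 : 0 < p by rewrite lt_neqAle eq_sym pn0.
  have phq : 0 < ph * (1 - ph) by rewrite mulr_gt0.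
  have Ccirc_fin : (C_circ < +oo)%E.
    rewrite ltey; apply/negP => /eqP CE; move: pe; rewrite /eps CE invey mule0 lee_fin.
    by rewrite leNgt p_gt0.
  have sumc J : uniq J -> ((delta^-1 * \sum_(j <- J) sc j)%:E <= delta^-1%:E * B_circ)%E.
    by move=> uJ; rewrite EFinM lee_wpmul2l ?lee_fin ?invr_ge0 ?(ltW d0) // sum_le_esum.
  have sumc0 J : 0 <= delta^-1 * \sum_(j <- J) sc j.
    by rewrite mulr_ge0 ?invr_ge0 ?(ltW d0) // sums0.
  pose gC s := fine (gamma_circ s).
  have gC0 s : 0 <= gC s by apply: fine_ge0.
  have circ_fin s : (s < sig.+1)%N -> gamma_circ s \is a fin_num.
    have [+ _] := prod_inf_ge Ccirc_fin (fun s _ => gcirc0 s) (sumc0 [::]) (sumc [::] uniq0).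
    exact.
  have circ_le J : uniq J ->
      ((delta^-1 * (\sum_(j <- J) sc j) * \prod_(s < sig.+1) gC s)%:E <= C_circ)%E.
    by move=> uJ; have [] := prod_inf_ge Ccirc_fin (fun s _ => gcirc0 s) (sumc0 J) (sumc J uJ).
  have Ccirc0 : (0 <= C_circ)%E.
    by have := circ_le [::] uniq0; rewrite big_nil mulr0 mul0r.
  pose cc := fine C_circ.
  have ccE : C_circ = cc%:E by rewrite fineK // ge0_fin_numE.
  have cc0 : 0 <= cc by apply: fine_ge0.
  pose c0 := p / (ph * (1 - ph)).
  have c00 : 0 <= c0 by rewrite divr_ge0 // ltW.
  exists gC, (c0 / delta * \prod_(s < sig.+1) gC s), (c0 * cc); split=> //.
  - by split; rewrite // mulr_ge0 ?prodr_ge0 // divr_ge0 // ltW.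
  - move=> J uJ; rewrite -mulr_sumr; have := circ_le J uJ; rewrite ccE lee_fin => le_cc.
    apply: le_trans (ler_wpM2l c00 le_cc); rewrite le_eqVlt; apply/orP; left; apply/eqP.
    ring.
  (* Since [p_circ = 1 - Bb], this is [p <= eps] rearranged; [cc = 0], where one cannot divide, is
     treated apart. *)
  - rewrite -lerBrDl; have [->|ccn0] := eqVneq cc 0; first by rewrite mulr0 subr_ge0.
    have ccp : 0 < cc by rewrite lt_neqAle eq_sym ccn0.
    move: pe; rewrite /eps pcE ccE inver (negbTE ccn0) -!EFinM lee_fin ler_pdivlMr // => le_p.
    by rewrite /c0 mulrAC ler_pdivrMr // [X in _ <= X]mulrC.
  - move=> _ s k j ss Dj; have [a0 _] := csub s k ss.
    have le_g : (alpha_circ s k <= gamma_circ s)%E.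
      exact: (le_bigmax _ (fun k => alpha_circ s k) k).
    have af : alpha_circ s k != +oo%E.
      apply/negP => /eqP aE; move: le_g; rewrite aE leye_eq => /eqP gE.
      by move: (circ_fin s ss); rewrite gE.
    have := alpha_const_le af (a0 j) Dj => le_a.
    apply: le_trans le_a _; rewrite ler_wpM2r // -lee_fin !fineK ?circ_fin //.
    by rewrite ge0_fin_numE ?alpha_const_ge0 // ltey.
(* The minimum with 1 in [delta] covers both alternatives of the factor, so one constant serves
   every [S]. *)
have delta_bound k (S : pred nat) :
    delta <= \prod_(s < sig.+1) (if S s then betasup s k else 1).
  apply: le_trans (bigmin_le _ k _) _; apply: ler_prod => s _.
  by rewrite le_min ler01 bs_ge0 /=; case: ifP => _; rewrite ge_min lexx ?orbT.
have beta_bound k s0 (S : pred nat) : (s0 <= sig)%N -> S s0 ->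
    r k <= rh (Some s0) k * \prod_(s < sig.+1) (if S s then betasup s k else 1).
  move=> ss0 Ss0; have [rh0 _] := rhat_prob s0 ss0.
  apply: (@le_trans _ _ ((\prod_(s < sig.+1) b s s0 k) * rhat s0 k)).
    apply: ereal_inf_ratio (betaE s0 k ss0) => // c [c0 le_c]; by split.
  (* Factor by factor: inside [S] the supremum bounds [b s s0 k]; outside [S] the charge differs
     from [s0], so [b s s0 k] is at most 1. *)
  rewrite mulrC ler_wpM2l //; apply: ler_prod => s _.
  rewrite ltW ?b0 //=; case: ifP => [_|Ss]; first exact: b_le.
  by apply: b1 => //; apply: contraFneq Ss => <-.
have rh_prob t : (odflt 0%N t <= sig)%N ->
    (forall k, 0 <= rh t k) /\ \sum_(k < m) rh t k = 1.
  by case: t => [s|_] //= ss; apply: rhat_prob.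
have Xones w : Xbar w i = `[< forall N, update_ones phi (mu ^~ w) N i >].
  exact: (maximal_trajectory_ones phi_ok i (Xmax w)).
have XE : ~` [set w | Xbar w i = true] = [set w | zero_site phi (mu ^~ w) i].
  apply/seteqP; split => w /=; rewrite Xones.
    by move=> /negP/asboolPn/existsNP[N /negP nN]; apply/asboolP; exists N.
  by move=> /asboolP[N /negP nN] /asboolP all1; apply: nN.
have mX : measurable [set w | Xbar w i = true].
  rewrite (_ : [set w | _] = \bigcap_N [set w | update_ones phi (mu ^~ w) N i]).
    apply: bigcapT_measurable => N; apply: (@measurable_update_ones _ _ h).
      by move=> k; have [] := phi_ok k.
    by move=> j l; have [] := law j.
  apply/seteqP; split => w /=; rewrite Xones.
    by move=> /asboolP all1 N _; apply: all1.
  by move=> all1; apply/asboolP => N; apply: all1.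
rewrite -probability_setC // XE.
apply: (prob_zero_site law indep (rh := rh) (abul := abul) (acirc := acirc) (sb := sb)
  (sc := sc) (L := L) (A := A) (delta := delta) _ h_morph phi_ok _ p01 ph01 rh_prob
  _ asub csub _ _ back_bul back_circ BbBc bs_ge0 _ _ _ _ bul_bound circ_bound _ gcE
  delta01 delta_bound beta_bound) => //.
- by move=> j; rewrite mulr_ge0.
- by move=> j; rewrite mulr_ge0.
- by move=> k j; apply: (le_bigmax _ (fun k => abul sig k j) k).
- by move=> k j; apply: (le_bigmax _ (fun k => acirc sig k j) k).
Qed.
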